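(* (i) $\mathbf{Sem}(S_{\mathrm{I}^{\mathrm{sol}}}^{\mathbf{s}})=\mathbf{Sem}(S_{\mathrm{Abel}}^{\mathbf{s}})$, and a Banach Lie algebra $\mathcal{L}$ belongs to this class if and only if $\mathcal{L}$ has no non-zero commutative finite-dimensional Lie subideals. (ii) The map $K:\mathcal{L}\mapsto K(\mathcal{L})=\mathrm{Centre}(\mathcal{L})$, for each Banach Lie algebra $\mathcal{L}$, is a lower stable preradical, and $(S_{\mathrm{I}^{\mathrm{sol}}}^{\mathbf{s}})^{\ast}=(S_{\mathrm{Abel}}^{\mathbf{s}})^{\ast}=(K^{\mathbf{s}})^{\ast}$. (iii) The restriction of $(S_{\mathrm{Abel}}^{\mathbf{s}})^{\ast}$ to finite-dimensional Lie algebras is the classical solvable radical: $(S_{\mathrm{Abel}}^{\mathbf{s}})^{\ast}(\mathcal{L})=\mathrm{rad}(\mathcal{L})$ for every finite-dimensional complex Lie algebra $\mathcal{L}$.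
   Context: A Banach Lie algebra is a complex Lie algebra $\mathcal{L}$ which is a Banach space in a norm such that, for some $t_{\mathcal{L}}>0$, $\|[a,b]\|\leq t_{\mathcal{L}}\|a\|\|b\|$ for all $a,b\in\mathcal{L}$. Morphisms are bounded Lie homomorphisms with dense image (category $\overline{\mathbf{L}}$). A preradical is a map $R$ sending each Banach Lie algebra $\mathcal{L}$ to a closed Lie ideal $R(\mathcal{L})$ of $\mathcal{L}$ such that $f(R(\mathcal{L}))\subseteq R(\mathcal{M})$ for each morphism $f:\mathcal{L}\to\mathcal{M}$. It is lower stable if $R(R(\mathcal{L}))=R(\mathcal{L})$ for all $\mathcal{L}$. $\mathbf{Sem}(R)=\{\mathcal{L}:R(\mathcal{L})=\{0\}\}$. A Lie subalgebra $I$ of $\mathcal{L}$ is a Lie subideal if there are Lie subalgebras $I=J_{0}\subseteq J_{1}\subseteq\cdots\subseteq J_{n}=\mathcal{L}$ with each $J_{i}$ a Lie ideal of $J_{i+1}$; if $I$ is closed all $J_i$ can be chosen closed. $S_{\mathrm{I}^{\mathrm{sol}}}(\mathcal{L})$ is the closed linear span of the union of all finite-dimensional solvable Lie ideals of $\mathcal{L}$. $S_{\mathrm{Abel}}(\mathcal{L})$ is the closed linear span of the union of all (closed) commutative Lie ideals of $\mathcal{L}$. Both are preradicals. For a preradical $R$, $R^{\mathbf{s}}(\mathcal{L})$ is the closed linear span of the union of all closed Lie subideals $I$ of $\mathcal{L}$ with $R(I)=I$ (it is again a preradical). For a preradical $R$, put $R^{(0)}(\mathcal{L})=\{0\}$,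 $R^{(\alpha+1)}(\mathcal{L})=q_{\alpha}^{-1}\bigl(R(\mathcal{L}/R^{(\alpha)}(\mathcal{L}))\bigr)$ where $q_{\alpha}:\mathcal{L}\to\mathcal{L}/R^{(\alpha)}(\mathcal{L})$ is the quotient map, and $R^{(\alpha)}(\mathcal{L})=\overline{\bigcup_{\alpha'<\alpha}R^{(\alpha')}(\mathcal{L})}$ for limit ordinals $\alpha$; $R^{\ast}(\mathcal{L})$ is the value at which this increasing transfinite chain of closed Lie ideals stabilizes. $\mathrm{rad}(\mathcal{L})$ is the maximal solvable Lie ideal of a finite-dimensional Lie algebra $\mathcal{L}$. *)

(* Defs.v *)
From HB Require Import structures.
From mathcomp Require Import all_boot all_order all_algebra.
From mathcomp Require Import generic_quotient ring_quotient complex.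
From mathcomp Require Import all_classical all_reals all_analysis.
From mathcomp Require Import ring lra.

Set Implicit Arguments.
Unset Strict Implicit.
Unset Printing Implicit Defensive.

Import Order.TTheory GRing.Theory Num.Theory.
Import numFieldNormedType.Exports.

Local Open Scope classical_set_scope.
Local Open Scope ring_scope.
Local Open Scope complex_scope.

(* Norms take values in the nonnegative reals of R[i], and 0 < t in R[i] forces
   t to be real. *)
HB.mixin Record isBanachLie (R : realType) L & CompleteNormedModule R[i] L := {
  lie : L -> L -> L;
  lie_linearl : forall (a : R[i]) (x y z : L),
    lie (a *: x + y) z = a *: lie x z + lie y z;
  lie_linearr : forall (a : R[i]) (x y z : L),
    lie z (a *: x + y) = a *: lie z x + lie z y;
  lie_alternating : forall x : L, lie x x = 0;
  lie_jacobi : forall x y z : L,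
    lie x (lie y z) + lie y (lie z x) + lie z (lie x y) = 0;
  lie_bounded : exists2 t : R[i], 0 < t &
    forall x y : L, `|lie x y| <= t * `|x| * `|y|
}.

#[short(type="banachLieType")]
HB.structure Definition BanachLie (R : realType) :=
  {L of CompleteNormedModule R[i] L & isBanachLie R L}.

Section LieTheory.
Context {R : realType} {L : banachLieType R}.

Lemma lieNr (x y : L) : lie x (- y) = - lie x y.
Proof.
have := lie_linearr (-1) y 0 x.
have := lie_linearr (-1) 0 0 x.
by rewrite !scaleN1r oppr0 !addr0 addNr => -> ->; rewrite addr0.
Qed.

Lemma lieDr (x y z : L) : lie x (y + z) = lie x y + lie x z.
Proof. by have := lie_linearr 1 y z x; rewrite !scale1r. Qed.

Lemma lieDl (x y z : L) : lie (x + y) z = lie x z + lie y z.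
Proof. by have := lie_linearl 1 x y z; rewrite !scale1r. Qed.

Lemma lieC (x y : L) : lie x y = - lie y x.
Proof.
have := lie_alternating (x + y); rewrite lieDl !lieDr !lie_alternating.
by rewrite add0r addr0 => /eqP; rewrite addr_eq0 => /eqP.
Qed.

Lemma lieNl (x y : L) : lie (- x) y = - lie x y.
Proof. by rewrite lieC lieNr opprK lieC. Qed.

End LieTheory.

Section LieSubsets.
Context {R : realType} {L : banachLieType R}.
Implicit Types (A I J : set L).

Definition lie_subspace A :=
  A 0 /\ forall (a : R[i]) (x y : L), A x -> A y -> A (a *: x + y).

Definition lie_subalgebra A :=
  lie_subspace A /\ forall x y : L, A x -> A y -> A (lie x y).

Definition lie_ideal_in J A :=
  [/\ lie_subspace J, J `<=` A & forall x y : L, A x -> J y -> J (lie x y)].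

Definition lie_ideal J := lie_ideal_in J setT.

Definition closed_subalgebra A := closed A /\ lie_subalgebra A.

Definition closed_ideal J := closed J /\ lie_ideal J.

Definition lie_subideal I := exists (n : nat) (J : nat -> set L),
  [/\ J 0%N = I, J n = setT,
      forall i, (i <= n)%N -> lie_subalgebra (J i) &
      forall i, (i < n)%N -> lie_ideal_in (J i) (J i.+1)].

Definition lin_span A : set L := smallest lie_subspace A.

Definition closed_span A : set L := closure (lin_span A).

Definition finite_dim A := exists s : seq L, A = lin_span [set` s].

Definition lie_commutative A := forall x y : L, A x -> A y -> lie x y = 0.

Definition derived A : set L := lin_span [set lie x y | x in A & y in A].

Definition lie_solvable A := exists n : nat, iter n derived A = [set 0].

Definition lie_center : set L := [set x | forall y : L, lie x y = 0].

Definition is_solvable_radical J :=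
  [/\ lie_ideal J, lie_solvable J &
      forall I, lie_ideal I -> lie_solvable I -> I `<=` J].

End LieSubsets.

Lemma ball_norm_lt (K : numFieldType) (V : normedModType K) (x y : V) (e : K) :
  ball x e y <-> `|x - y| < e.
Proof. by rewrite -ball_normE. Qed.

Section Subalgebra.
Variables (R : realType) (L : banachLieType R) (I : set L).
Variable hI : closed_subalgebra I.

Definition subalg_pred of closed_subalgebra I : {pred L} := fun x => x \in I.

Lemma subalg_submod : submod_closed (subalg_pred hI).
Proof.
have [_ [[I0 IZ] _]] := hI; split; first exact: mem_set.
by move=> a x y /set_mem Ix /set_mem Iy; apply/mem_set/IZ.
Qed.

HB.instance Definition _ :=
  GRing.isSubmodClosed.Build _ L (subalg_pred hI) subalg_submod.

Record subalg := Subalg {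
  subalg_val :> L; subalg_valP : subalg_val \in subalg_pred hI }.

HB.instance Definition _ := [isSub for subalg_val].
HB.instance Definition _ := [Choice of subalg by <:].
HB.instance Definition _ := [SubChoice_isSubLmodule of subalg by <:].

Definition subalg_norm (x : subalg) : R[i] := `|subalg_val x|.

Lemma subalg_normD x y :
  subalg_norm (x + y) <= subalg_norm x + subalg_norm y.
Proof. exact: ler_normD. Qed.

Lemma subalg_normZ (a : R[i]) x : subalg_norm (a *: x) = `|a| * subalg_norm x.
Proof. exact: normrZ. Qed.

Lemma subalg_norm0_eq0 x : subalg_norm x = 0 -> x = 0.
Proof. by move=> x0; apply/val_inj/normr0_eq0. Qed.

HB.instance Definition _ := Lmodule_isNormed.Build R[i] subalg
  subalg_normD subalg_normZ subalg_norm0_eq0.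

Lemma subalg_complete (F : set_system subalg) :
  ProperFilter F -> cauchy F -> cvg F.
Proof.
move=> FF /cauchyP Fc.
have : cauchy (subalg_val @ F).
  apply/cauchy_exP => e e0; have [x Fx] := Fc e e0.
  exists (subalg_val x); apply: (@filterS _ F _ (ball x e)) => //.
  by move=> y /ball_norm_lt xy; apply/ball_norm_lt.
move=> /(@cauchy_cvg L) /cvg_ex[/= l /cvgrPdist_lt Fl].
have Il : I l.
  have [cI _] := hI; apply: cI => B /nbhs_ballP[e e0 eB].
  have /filter_ex[x lx] := Fl e e0.
  exists (subalg_val x); split; first exact/set_mem/subalg_valP.
  exact/eB/ball_norm_lt.
apply/cvg_ex; exists (Subalg (mem_set Il)); apply/cvgrPdist_lt => e e0.
by apply: filterS (Fl e e0) => x.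
Qed.

HB.instance Definition _ := Uniform_isComplete.Build subalg subalg_complete.

Lemma subalg_lieP (x y : subalg) :
  lie (subalg_val x) (subalg_val y) \in subalg_pred hI.
Proof.
have [_ [_ h]] := hI.
by apply/mem_set/h; apply/set_mem/subalg_valP.
Qed.

Definition subalg_lie (x y : subalg) : subalg := Subalg (subalg_lieP x y).

Lemma subalg_lie_linearl (a : R[i]) (x y z : subalg) :
  subalg_lie (a *: x + y) z = a *: subalg_lie x z + subalg_lie y z.
Proof. by apply: val_inj; exact: lie_linearl. Qed.

Lemma subalg_lie_linearr (a : R[i]) (x y z : subalg) :
  subalg_lie z (a *: x + y) = a *: subalg_lie z x + subalg_lie z y.
Proof. by apply: val_inj; exact: lie_linearr. Qed.

Lemma subalg_lie_alternating (x : subalg) : subalg_lie x x = 0.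
Proof. by apply: val_inj; exact: lie_alternating. Qed.

Lemma subalg_lie_jacobi (x y z : subalg) :
  subalg_lie x (subalg_lie y z) + subalg_lie y (subalg_lie z x)
    + subalg_lie z (subalg_lie x y) = 0.
Proof. by apply: val_inj; exact: lie_jacobi. Qed.

Lemma subalg_lie_bounded : exists2 t : R[i], 0 < t &
  forall x y : subalg, `|subalg_lie x y| <= t * `|x| * `|y|.
Proof.
by have [t t0 lt] := @lie_bounded R L; exists t => // x y; exact: lt.
Qed.

HB.instance Definition _ := isBanachLie.Build R subalg
  subalg_lie_linearl subalg_lie_linearr subalg_lie_alternating
  subalg_lie_jacobi subalg_lie_bounded.

End Subalgebra.

Section Quotient.
Variables (R : realType) (L : banachLieType R) (J : set L).
Variable hJ : closed_ideal J.

Definition ideal_pred of closed_ideal J : {pred L} := fun x => x \in J.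

Lemma ideal_zmod : zmod_closed (ideal_pred hJ).
Proof.
have [_ [[J0 JZ] _ _]] := hJ; split; first exact: mem_set.
move=> x y /set_mem Jx /set_mem Jy; apply/mem_set.
by rewrite -scaleN1r addrC; exact: JZ.
Qed.

HB.instance Definition _ :=
  GRing.isZmodClosed.Build L (ideal_pred hJ) ideal_zmod.

Definition lie_quotient := Quotient.quot (ideal_pred hJ).

HB.instance Definition _ := GRing.Zmodule.on lie_quotient.

Definition quotient_map (x : L) : lie_quotient :=
  (\pi_(Quotient.quot (ideal_pred hJ)) x)%qT.

Definition quotient_repr (q : lie_quotient) : L := repr q.

Lemma quotient_reprK q : quotient_map (quotient_repr q) = q.
Proof. exact: reprK. Qed.

Lemma quotient_mapP x y : quotient_map x = quotient_map y <-> J (x - y).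
Proof.
split=> [/eqP|Jxy].
  by rewrite /quotient_map -Quotient.idealrBE => /set_mem.
by apply/eqP; rewrite /quotient_map -Quotient.idealrBE; exact/mem_set.
Qed.

Lemma quotient_mapD x y :
  quotient_map (x + y) = quotient_map x + quotient_map y.
Proof. exact: Quotient.pi_add. Qed.

Lemma quotient_mapN x : quotient_map (- x) = - quotient_map x.
Proof. exact: Quotient.pi_opp. Qed.

Lemma quotient_ind (P : lie_quotient -> Prop) :
  (forall x, P (quotient_map x)) -> forall q, P q.
Proof. by move=> h q; rewrite -[q]quotient_reprK. Qed.

Lemma ideal_scale (a : R[i]) x : J x -> J (a *: x).
Proof.
by case: hJ => _ [[J0 JZ] _ _] Jx; rewrite -[_ *: _]addr0; exact: JZ.
Qed.

Lemma ideal_add x y : J x -> J y -> J (x + y).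
Proof.
by case: hJ => _ [[J0 JZ] _ _] Jx Jy; rewrite -[x]scale1r; exact: JZ.
Qed.

Definition quotient_scale (a : R[i]) (q : lie_quotient) : lie_quotient :=
  quotient_map (a *: quotient_repr q).

Lemma quotient_mapZ_subproof (a : R[i]) x :
  quotient_map (a *: x) = quotient_scale a (quotient_map x).
Proof.
apply/quotient_mapP; rewrite -scalerBr; apply: ideal_scale.
by apply/quotient_mapP; rewrite quotient_reprK.
Qed.

Lemma quotient_scaleA (a b : R[i]) q :
  quotient_scale a (quotient_scale b q) = quotient_scale (a * b) q.
Proof.
by elim/quotient_ind: q => x; rewrite -!quotient_mapZ_subproof scalerA.
Qed.

Lemma quotient_scale1 : left_id 1 quotient_scale.
Proof.
by elim/quotient_ind => x; rewrite -!quotient_mapZ_subproof scale1r.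
Qed.

Lemma quotient_scaleDr : right_distributive quotient_scale +%R.
Proof.
move=> a; elim/quotient_ind => x; elim/quotient_ind => y.
by rewrite -quotient_mapD -!quotient_mapZ_subproof scalerDr quotient_mapD.
Qed.

Lemma quotient_scaleDl q :
  {morph quotient_scale^~ q : a b / a + b}.
Proof.
move=> a b; elim/quotient_ind: q => x.
by rewrite -!quotient_mapZ_subproof scalerDl quotient_mapD.
Qed.

HB.instance Definition _ := GRing.Zmodule_isLmodule.Build R[i] lie_quotient
  quotient_scaleA quotient_scale1 quotient_scaleDr quotient_scaleDl.

Lemma quotient_mapZ (a : R[i]) x : quotient_map (a *: x) = a *: quotient_map x.
Proof. exact: quotient_mapZ_subproof. Qed.

Lemma quotient_map0 : quotient_map 0 = 0.
Proof. by rewrite -[0 in LHS](scale0r 0) quotient_mapZ scale0r. Qed.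

Lemma normReE (x : L) : `|x| = (complex.Re `|x|)%:C.
Proof. by rewrite RRe_real // ger0_real. Qed.

Definition quotient_infnorm (q : lie_quotient) : R :=
  inf [set complex.Re `|x| | x in [set x | quotient_map x = q]].

Definition quotient_norm (q : lie_quotient) : R[i] := (quotient_infnorm q)%:C.

Lemma quotient_norm_has_lbound q :
  has_lbound [set complex.Re `|x| | x in [set x | quotient_map x = q]].
Proof.
by exists 0 => _ [x _ <-]; rewrite -lecR -normReE; exact: normr_ge0.
Qed.

Lemma quotient_norm_le x : quotient_norm (quotient_map x) <= `|x|.
Proof.
rewrite (normReE x) lecR; apply: ge_inf; first exact: quotient_norm_has_lbound.
by exists x.
Qed.

Lemma quotient_norm_lt q (e : R[i]) : quotient_norm q < e ->
  exists2 x, quotient_map x = q & `|x| < e.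
Proof.
move=> qe; have er : e = (complex.Re e)%:C.
  rewrite RRe_real // (ger_real (ltW qe)).
  by apply/complex_realP; exists (quotient_infnorm q).
move: qe; rewrite er ltcR => /inf_lt.
case=> [|_ [x qx <-] xe]; last by exists x => //; rewrite normReE ltcR.
by exists (complex.Re `|quotient_repr q|), (quotient_repr q) => //;
  exact: quotient_reprK.
Qed.

Lemma quotient_norm_lb q (e : R[i]) :
  (forall x, quotient_map x = q -> e <= `|x|) -> e <= quotient_norm q.
Proof.
move=> eq; have er : e = (complex.Re e)%:C.
  by rewrite RRe_real // (ler_real (eq _ (quotient_reprK q))) ger0_real.
rewrite er lecR; apply: lb_le_inf.
  by exists (complex.Re `|quotient_repr q|), (quotient_repr q) => //;
    exact: quotient_reprK.
by move=> _ [x /eq + <-]; rewrite er (normReE x) lecR.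
Qed.

Lemma quotient_norm_lbM q (c k : R[i]) : 0 <= k ->
  (forall x, quotient_map x = q -> c <= k * `|x|) -> c <= k * quotient_norm q.
Proof.
rewrite le_eqVlt => /predU1P[<-|k0] ck.
  by rewrite mul0r; have := ck _ (quotient_reprK q); rewrite mul0r.
rewrite -ler_pdivrMl //; apply: quotient_norm_lb => x /ck.
by rewrite ler_pdivrMl.
Qed.

Lemma quotient_norm_ge0 q : 0 <= quotient_norm q.
Proof. by apply: quotient_norm_lb. Qed.

Lemma quotient_normD p q :
  quotient_norm (p + q) <= quotient_norm p + quotient_norm q.
Proof.
apply/ler_addgt0Pr => e e0.
have e20 : 0 < e / 2 by rewrite divr_gt0.
have [x <- xe] : exists2 x, quotient_map x = p & `|x| < quotient_norm p + e / 2.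
  by apply: quotient_norm_lt; rewrite ltrDl.
have [y <- ye] : exists2 x, quotient_map x = q & `|x| < quotient_norm q + e / 2.
  by apply: quotient_norm_lt; rewrite ltrDl.
rewrite -quotient_mapD (le_trans (quotient_norm_le _)) //.
rewrite (le_trans (ler_normD _ _)) // (le_trans (ltW (ltrD xe ye))) //.
by rewrite addrACA -splitr.
Qed.

Lemma quotient_normZ_le (a : R[i]) q :
  quotient_norm (a *: q) <= `|a| * quotient_norm q.
Proof.
have [->|a0] := eqVneq a 0.
  rewrite scale0r normr0 mul0r.
  by rewrite -quotient_map0 (le_trans (quotient_norm_le _)) // normr0.
rewrite -ler_pdivrMl ?normr_gt0 //; apply: quotient_norm_lb => x <-.
by rewrite -quotient_mapZ ler_pdivrMl ?normr_gt0 // -normrZ quotient_norm_le.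
Qed.

Lemma quotient_normZ (a : R[i]) q :
  quotient_norm (a *: q) = `|a| * quotient_norm q.
Proof.
apply/eqP; rewrite eq_le quotient_normZ_le /=.
have [->|a0] := eqVneq a 0; first by rewrite normr0 mul0r quotient_norm_ge0.
rewrite -ler_pdivlMl ?normr_gt0 // -normfV.
by rewrite -{1}[q](scalerK a0) quotient_normZ_le.
Qed.

Lemma quotient_norm0_eq0 q : quotient_norm q = 0 -> q = 0.
Proof.
elim/quotient_ind: q => x q0.
rewrite -quotient_map0; apply/quotient_mapP; rewrite subr0.
have [cJ _] := hJ; apply: cJ => B.
move=> /nbhs_ballP[e e0 eB].
have [|y /quotient_mapP Jyx ye] := @quotient_norm_lt (quotient_map x) e.
  by rewrite q0.
exists (x - y); split; first by rewrite -opprB -scaleN1r; exact: ideal_scale.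
by apply/eB/ball_norm_lt; rewrite opprB addrC subrK.
Qed.

HB.instance Definition _ := Lmodule_isNormed.Build R[i] lie_quotient
  quotient_normD quotient_normZ quotient_norm0_eq0.

Lemma quotient_normE q : `|q| = quotient_norm q. Proof. by []. Qed.

Lemma quotient_complete (F : set_system lie_quotient) :
  ProperFilter F -> cauchy F -> cvg F.
Proof.
move=> FF /cauchyP Fc.
pose r n : R[i] := 2^-1 ^+ n.
have r0 n : 0 < r n by rewrite exprn_gt0 // invr_gt0.
have rS n : r n = r n.+1 + r n.+1.
  by rewrite /r exprS mulrC -splitr.
have rlt e : 0 < e -> exists n, r n < e.
  move=> e0; have er : e = (complex.Re e)%:C by rewrite RRe_real // gtr0_real.
  have e0' : 0 < complex.Re e by rewrite -ltcR -er.
  pose n := Num.truncn (complex.Re e)^-1; exists n.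
  have h : (complex.Re e)^-1 < n.+1%:R by apply: truncnS_gt.
  rewrite /r exprVn invf_plt ?posrE ?exprn_gt0 // er -fmorphV /=.
  have -> : 2 ^+ n = (2 ^+ n : R)%:C by rewrite rmorphXn /= rmorph_nat.
  rewrite ltcR (lt_le_trans h) // -natrX ler_nat.
  exact: ltn_expl.
have /boolp.choice[xs xsF] : forall n, exists x, F (ball x (r n)).
  by move=> n; exact: Fc.
have xsd n : quotient_norm (xs n.+1 - xs n) < r n.+1 + r n.
  have [y [/ball_norm_lt y1 /ball_norm_lt y2]] :=
    @filter_ex _ F FF _ (filterI (xsF n.+1) (xsF n)).
  rewrite -(subrKA y) (le_lt_trans (quotient_normD _ _)) //.
  by apply: ltrD; rewrite // -quotient_normE distrC.
have /boolp.choice[d dP] : forall n, exists x,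
    quotient_map x = xs n.+1 - xs n /\ `|x| < r n.+1 + r n.
  move=> n.
  by have [x ? ?] := quotient_norm_lt (xsd n); exists x.
pose ys := fix ys n := if n is m.+1 then ys m + d m else quotient_repr (xs 0%N).
have ysE n : quotient_map (ys n) = xs n.
  elim: n => [|n IH] /=; first exact: quotient_reprK.
  by rewrite quotient_mapD IH (dP n).1 addrC subrK.
pose s n : R[i] := r n + r n + r n.
have tail k n : `|ys (n + k)%N - ys n| <= s n - s (n + k)%N.
  elim: k => [|k IH]; first by rewrite addn0 !subrr normr0.
  rewrite addnS /= addrAC (le_trans (ler_normD _ _)) //.
  rewrite (le_trans (lerD IH (ltW (dP (n + k)%N).2))) //.
  have -> : r (n + k).+1 + r (n + k)%N = s (n + k)%N - s (n + k).+1.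
    by rewrite /s (rS (n + k)%N); ring.
  by rewrite addrA subrK.
have tail' n m : (n <= m)%N -> `|ys n - ys m| <= s n.
  move=> nm; rewrite distrC -(subnKC nm) (le_trans (tail _ _)) //.
  by rewrite gerBl /s !addr_ge0 // ltW.
have slt e : 0 < e -> exists n, s n < e.
  move=> e0; have [|n rn] := rlt (e / 3); first by rewrite divr_gt0.
  exists n; rewrite /s (_ : e = e / 3 + e / 3 + e / 3) ?ltrD //.
  by field.
have : cauchy (ys @ \oo).
  apply/cauchy_exP => e e0; have [n sn] := slt e e0.
  exists (ys n); exists n => // m /= nm; apply/ball_norm_lt.
  exact: le_lt_trans (tail' _ _ nm) sn.
move=> /(@cauchy_cvg L) /cvg_ex[/= l /cvgrPdist_lt yl].
have yl' n : `|l - ys n| <= s n.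
  apply/ler_addgt0Pr => e e0.
  have [m [lm /= nm]] :=
    @filter_ex _ \oo _ _ (filterI (yl e e0) (nbhs_infty_ge n)).
  rewrite -(subrKA (ys m)) (le_trans (ler_normD _ _)) //.
  by rewrite [leRHS]addrC lerD ?(ltW lm) // distrC tail'.
apply/cvg_ex; exists (quotient_map l); apply/cvgrPdist_lt => e e0.
have e20 : 0 < e / 2 by rewrite divr_gt0.
have [n sn] := slt _ e20.
apply: (@filterS _ F _ (ball (xs n) (r n))) => // x /ball_norm_lt xn.
rewrite -(subrKA (xs n)) (le_lt_trans (ler_normD _ _)) // (splitr e) ltrD //.
  rewrite -ysE -[quotient_map (ys n)]opprK -quotient_mapN -opprB.
  rewrite (le_lt_trans _ sn) // (le_trans _ (yl' n)) //.
  by rewrite opprB quotient_mapN opprK -quotient_mapN -quotient_mapD;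
    exact: quotient_norm_le.
apply: lt_trans xn (le_lt_trans _ sn).
by rewrite /s -addrA lerDl addr_ge0 // ltW.
Qed.

HB.instance Definition _ :=
  Uniform_isComplete.Build lie_quotient quotient_complete.

Definition quotient_lie (p q : lie_quotient) : lie_quotient :=
  quotient_map (lie (quotient_repr p) (quotient_repr q)).

Lemma quotient_map_lie x y :
  quotient_map (lie x y) = quotient_lie (quotient_map x) (quotient_map y).
Proof.
have [_ [_ _ JJ]] := hJ.
have JN z : J z -> J (- z) by rewrite -scaleN1r; exact: ideal_scale.
apply/quotient_mapP; set x' := quotient_repr _; set y' := quotient_repr _.
have Jx : J (x - x') by apply/quotient_mapP; rewrite quotient_reprK.
have Jy : J (y - y') by apply/quotient_mapP; rewrite quotient_reprK.
have -> : lie x y - lie x' y' = - lie y (x - x') + lie x' (y - y').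
  have -> : - lie y (x - x') = lie (x - x') y by rewrite -lieC.
  by rewrite lieDl lieDr lieNr lieNl addrA subrK.
by apply: ideal_add; [apply: JN|]; apply: JJ.
Qed.

Lemma quotient_lie_linearl (a : R[i]) (x y z : lie_quotient) :
  quotient_lie (a *: x + y) z = a *: quotient_lie x z + quotient_lie y z.
Proof.
elim/quotient_ind: x => x; elim/quotient_ind: y => y; elim/quotient_ind: z => z.
rewrite -quotient_mapZ -quotient_mapD -!quotient_map_lie lie_linearl.
by rewrite quotient_mapD quotient_mapZ.
Qed.

Lemma quotient_lie_linearr (a : R[i]) (x y z : lie_quotient) :
  quotient_lie z (a *: x + y) = a *: quotient_lie z x + quotient_lie z y.
Proof.
elim/quotient_ind: x => x; elim/quotient_ind: y => y; elim/quotient_ind: z => z.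
rewrite -quotient_mapZ -quotient_mapD -!quotient_map_lie lie_linearr.
by rewrite quotient_mapD quotient_mapZ.
Qed.

Lemma quotient_lie_alternating (x : lie_quotient) : quotient_lie x x = 0.
Proof.
elim/quotient_ind: x => x.
by rewrite -quotient_map_lie lie_alternating quotient_map0.
Qed.

Lemma quotient_lie_jacobi (x y z : lie_quotient) :
  quotient_lie x (quotient_lie y z) + quotient_lie y (quotient_lie z x)
    + quotient_lie z (quotient_lie x y) = 0.
Proof.
elim/quotient_ind: x => x; elim/quotient_ind: y => y; elim/quotient_ind: z => z.
by rewrite -!quotient_map_lie -!quotient_mapD lie_jacobi quotient_map0.
Qed.

Lemma quotient_lie_bounded : exists2 t : R[i], 0 < t &
  forall x y : lie_quotient, `|quotient_lie x y| <= t * `|x| * `|y|.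
Proof.
have [t t0 lt] := @lie_bounded R L; exists t => // p q.
rewrite !quotient_normE; apply: quotient_norm_lbM => [|y yq].
  by rewrite mulr_ge0 ?quotient_norm_ge0 // ltW.
rewrite mulrAC; apply: quotient_norm_lbM => [|x xp].
  by rewrite mulr_ge0 // ltW.
rewrite -xp -yq -quotient_map_lie (le_trans (quotient_norm_le _)) //.
by rewrite mulrAC.
Qed.

HB.instance Definition _ := isBanachLie.Build R lie_quotient
  quotient_lie_linearl quotient_lie_linearr quotient_lie_alternating
  quotient_lie_jacobi quotient_lie_bounded.

End Quotient.

Section Preradicals.
Variable R : realType.

Definition bounded_operator (L M : banachLieType R) (f : L -> M) :=
  exists k : R[i], forall x, `|f x| <= k * `|x|.

Definition lie_morphism (L M : banachLieType R) (f : {linear L -> M}) :=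
  [/\ bounded_operator f, forall x y, f (lie x y) = lie (f x) (f y) &
      dense (range f)].

Definition ideal_map := forall L : banachLieType R, set L.

Definition is_preradical (P : ideal_map) :=
  (forall L, closed_ideal (P L)) /\
  (forall (L M : banachLieType R) (f : {linear L -> M}),
     lie_morphism f -> f @` P L `<=` P M).

(* P(I), computed in the Banach Lie algebra I, seen as a subset of L. *)
Definition map_on_subalgebra (P : ideal_map) (L : banachLieType R) (I : set L)
    (hI : closed_subalgebra I) : set L :=
  @subalg_val R L I hI @` P (subalg hI).

Definition lower_stable (P : ideal_map) := forall L : banachLieType R,
  exists h : closed_subalgebra (P L), map_on_subalgebra P h = P L.

Definition Sem (P : ideal_map) (L : banachLieType R) : Prop := P L = [set 0].

Definition S_Isol : ideal_map := fun L => closed_span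
  (\bigcup_(I in [set I : set L |
     [/\ lie_ideal I, finite_dim I & lie_solvable I]]) I).

Definition S_Abel : ideal_map := fun L => closed_span
  (\bigcup_(I in [set I : set L | closed_ideal I /\ lie_commutative I]) I).

Definition K_center : ideal_map := fun L => @lie_center R L.

Definition superposition (P : ideal_map) : ideal_map := fun L => closed_span
  (\bigcup_(I in [set I : set L | lie_subideal I /\
     exists hI : closed_subalgebra I, map_on_subalgebra P hI = I]) I).

(* q^{-1}(P(L/J)) for the quotient map q : L -> L/J; empty when J is not a
   closed ideal, which does not happen along the chain of a preradical. *)
Definition next_iterate (P : ideal_map) (L : banachLieType R) (J : set L) :
    set L :=
  [set x | exists hJ : closed_ideal J, P (lie_quotient hJ) (quotient_map hJ x)].

(* Ordinals are the positions of well-ordered types. *)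
Section Positions.
Variables (W : eqType) (le : rel W).

Definition wo_lt (v w : W) := (v != w) && le v w.

Definition is_zero (w : W) := forall v, ~~ wo_lt v w.

Definition is_successor (v w : W) :=
  wo_lt v w /\ forall u, wo_lt u w -> le u v.

Definition is_limit (w : W) :=
  ~ is_zero w /\ ~ exists v, is_successor v w.

Definition transfinite_iterates (P : ideal_map) (L : banachLieType R)
    (c : W -> set L) :=
  [/\ forall w, is_zero w -> c w = [set 0],
      forall v w, is_successor v w -> c w = next_iterate P (c v) &
      forall w, is_limit w -> c w = closure (\bigcup_(v in wo_lt^~ w) c v)].

End Positions.

(* The value J = c w of the chain at the position w is the one at which it
   stabilizes as soon as the following value equals J. *)
Definition star (P : ideal_map) : ideal_map := fun L =>
  [set x | exists (W : eqType) (le : rel W) (c : W -> set L) (w : W),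
     [/\ wochoice.well_order le, transfinite_iterates le P c,
         next_iterate P (c w) = c w & c w x]].

End Preradicals.

Arguments S_Isol R L : clear implicits.
Arguments S_Abel R L : clear implicits.
Arguments K_center R L : clear implicits.
Arguments superposition {R} P L.
Arguments star {R} P L.

(* Main.v *)
(* Whatever P is among S_Isol, S_Abel and the centre, P^s(L) contains every x
   such that C x is a subideal and is contained in the closed span of the
   solvable subideals. If there is no such x <> 0, there is no nonzero solvable
   subideal either (take the last nonzero derived algebra); hence Sem(P^s) does
   not depend on P. P^s(L) is a closed ideal because it is invariant under the
   automorphisms exp(t ad a). The transfinite chain stays inside every closed
   ideal J such that L/J is in Sem(P^s) and stabilizes at such an ideal, so
   (P^s)^*(L) is the smallest one, which again does not depend on P. If L is
   finite-dimensional, invariance under exp(t ad a) shows that the solvable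
   radical of an ideal of J is an ideal of J; going up a chain of subideals,
   every solvable subideal lies in the radical. Thus L/rad(L) is in the class,
   and (P^s)^*(L) is contained in rad(L); the converse inclusion holds because
   solvable ideals of L vanish in L/(P^s)^*(L). *)
Require Import Defs.
From mathcomp Require Import all_boot all_order all_algebra.
From mathcomp Require Import complex.
From mathcomp Require Import all_classical all_reals all_analysis.
From mathcomp Require Import ring.

Set Implicit Arguments.
Unset Strict Implicit.
Unset Printing Implicit Defensive.

Import Order.TTheory GRing.Theory Num.Theory.
Import numFieldNormedType.Exports.

Local Open Scope classical_set_scope.
Local Open Scope ring_scope.
Local Open Scope complex_scope.

(** * Closed spans and homomorphisms *)

(** Nothing in the definition of P^s places the bracket [a, v] in P^s(L) when v comes from a
    subideal I, since [a, v] need not lie in I. Automorphisms, however, permute the subideals I with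
    P(I) = I, and [a, v] is the limit of (exp(t ad a) v - v) / t, so the closedness of the span
    finishes the argument. Only small t matter. They are chosen so that t ad a has norm at most 1/8:
    the Cauchy product, which yields both the inverse exp(- t ad a) and the compatibility with
    brackets, loses a factor n^2 <= 4^n, and 4^n / 8^n still decays like 2^-n. The inverse has to be
    bounded too, so that closed subalgebras go to closed subalgebras. Functoriality of P^s is never
    established. Where a comparison along L/J -> L/J' is required, P^s(L/J) is first enlarged to the
    closed span of the solvable subideals, which every surjective bounded homomorphism respects.
    Minimality among the ideals with semisimple quotient also spares any comparison of chains
    indexed by different well-orders. *)

Lemma cauchy_bound_cvg (K : numFieldType) (V : completeNormedModType K)
    (s : nat -> K) (u : nat -> V) :
  (forall e, 0 < e -> exists n, s n < e) ->
  (forall n m, (n <= m)%N -> `|u n - u m| <= s n) ->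
  exists l, forall n, `|l - u n| <= s n.
Proof.
move=> slt tail; have : cauchy (u @ \oo).
  apply/cauchy_exP => e e0; have [n sn] := slt e e0.
  exists (u n); exists n => // m /= nm; rewrite -ball_normE /=.
  exact: le_lt_trans (tail _ _ nm) sn.
move=> /(@cauchy_cvg V) /cvg_ex[/= l /cvgrPdist_lt ul].
exists l => n; apply/ler_addgt0Pr => e e0.
have [m [lm /= nm]] :=
  @filter_ex _ \oo _ _ (filterI (ul e e0) (nbhs_infty_ge n)).
rewrite -(subrKA (u m)) (le_trans (ler_normD _ _)) //.
by rewrite [leRHS]addrC lerD ?(ltW lm) // distrC tail.
Qed.

Section GeometricDecay.
Context {R : realType} {V : normedModType R[i]}.
Implicit Types (u v : nat -> V).

(* Limits in the complex-valued norm are handled by explicit geometric bounds,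
   which avoids filters over R[i]. *)
Definition geom_decay u := exists c : R[i], forall n, `|u n| <= c * 2^-1 ^+ n.

Lemma geom_decay_c (c : R[i]) u : (forall n, `|u n| <= c * 2^-1 ^+ n) ->
  0 <= c.
Proof. by move=> /(_ 0%N); rewrite expr0 mulr1; exact: le_trans. Qed.

Lemma half_expr_lt (c e : R[i]) : 0 <= c -> 0 < e ->
  exists n, c * 2^-1 ^+ n < e.
Proof.
move=> c0 e0; pose a := complex.Re ((c + 1) / e).
have c10 : 0 < c + 1 by rewrite ltr_wpDl.
have aE : (c + 1) / e = a%:C by rewrite RRe_real // gtr0_real // divr_gt0.
have h : a < (Num.truncn a).+1%:R by apply: truncnS_gt.
pose n := Num.truncn a; exists n.
have cle : (c + 1) / e <= 2 ^+ n.
  have -> : 2 ^+ n = (2 ^+ n : R)%:C by rewrite rmorphXn /= rmorph_nat.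
  rewrite aE lecR (le_trans (ltW h)) // -natrX ler_nat; exact: ltn_expl.
rewrite exprVn ltr_pdivrMr ?exprn_gt0 //.
rewrite (@lt_le_trans _ _ (c + 1)) ?ltrDl //.
by rewrite mulrC -ler_pdivrMr.
Qed.

Lemma half_exprE n : 2^-1 ^+ n = (2^-1 ^+ n : R)%:C.
Proof. by rewrite rmorphXn fmorphV rmorph_nat. Qed.

Lemma half_expr_ltR (c e : R) : 0 <= c -> 0 < e -> exists n, c * 2^-1 ^+ n < e.
Proof.
rewrite -lecR -ltcR => c0 e0; have [n cn] := half_expr_lt c0 e0.
by exists n; rewrite -ltcR rmorphM /= -half_exprE.
Qed.

Lemma geom_decay_lt u (e : R[i]) : geom_decay u -> 0 < e ->
  exists n, `|u n| < e.
Proof.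
move=> [c uc] e0; have [n cn] := half_expr_lt (geom_decay_c uc) e0.
by exists n; exact: le_lt_trans (uc n) cn.
Qed.

(** This is how identities between limits are proved below: the difference of the two sides,
    constant in n, is rewritten as a sum of decaying sequences. *)
Lemma geom_decay_cst (x : V) : geom_decay (fun=> x) -> x = 0.
Proof.
move=> h; apply/eqP; rewrite -normr_eq0; apply/contraT => x0.
have e0 : 0 < `|x| by rewrite lt0r x0 normr_ge0.
by have [n] := geom_decay_lt h e0; rewrite ltxx.
Qed.

Lemma geom_decayD u v : geom_decay u -> geom_decay v ->
  geom_decay (fun n => u n + v n).
Proof.
move=> [c uc] [d vd]; exists (c + d) => n.
by rewrite (le_trans (ler_normD _ _)) // mulrDl lerD.
Qed.

Lemma geom_decayZ (a : R[i]) u : geom_decay u ->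
  geom_decay (fun n => a *: u n).
Proof.
move=> [c uc]; exists (`|a| * c) => n.
by rewrite normrZ -mulrA ler_wpM2l.
Qed.

Lemma geom_decayN u : geom_decay u -> geom_decay (fun n => - u n).
Proof. by move=> [c uc]; exists c => n; rewrite normrN. Qed.

Lemma eq_geom_decay u v : u =1 v -> geom_decay u -> geom_decay v.
Proof. by move=> uv [c uc]; exists c => n; rewrite -uv. Qed.

End GeometricDecay.

Lemma geom_decay_le {R : realType} {V W : normedModType R[i]}
    (k : R[i]) (u : nat -> V) (v : nat -> W) :
  0 <= k -> geom_decay u -> (forall n, `|v n| <= k * `|u n|) -> geom_decay v.
Proof.
move=> k0 [c uc] vu; exists (k * c) => n.
by rewrite (le_trans (vu n)) // -mulrA ler_wpM2l.
Qed.

Section Subspaces.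
Context {R : realType} {L : banachLieType R}.
Implicit Types (A B V : set L) (x y : L).

Lemma closure_decayP A x :
  closure A x <->
  exists2 y, (forall n, A (y n)) & geom_decay (fun n => x - y n).
Proof.
split=> [clA|[y Ay xy] B /nbhs_ballP[e e0 eB]].
  have /boolp.choice[y yP] : forall n, exists y, A y /\ `|x - y| < 2^-1 ^+ n.
    move=> n; have e0 : 0 < 2^-1 ^+ n :> R[i] by rewrite exprn_gt0 ?invr_gt0.
    by have [y [Ay /ball_norm_lt xy]] := clA _ (nbhsx_ballx x _ e0); exists y.
  exists y => [n|]; first exact: (yP n).1.
  by exists 1 => n; rewrite mul1r ltW // (yP n).2.
have [n xn] := geom_decay_lt xy e0.
by exists (y n); split=> //; apply/eB/ball_norm_lt.
Qed.

Lemma closed_decay A (y : nat -> L) x : closed A -> (forall n, A (y n)) ->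
  geom_decay (fun n => x - y n) -> A x.
Proof. by move=> cA Ay xy; apply/cA/closure_decayP; exists y. Qed.

Lemma subspaceD V x y : lie_subspace V -> V x -> V y -> V (x + y).
Proof. by case=> _ h Vx Vy; rewrite -[x]scale1r; exact: h. Qed.

Lemma subspaceZ V (a : R[i]) x : lie_subspace V -> V x -> V (a *: x).
Proof. by case=> V0 h Vx; rewrite -[_ *: _]addr0; exact: h. Qed.

Lemma subspaceN V x : lie_subspace V -> V x -> V (- x).
Proof. by rewrite -scaleN1r; exact: subspaceZ. Qed.

Lemma subspaceB V x y : lie_subspace V -> V x -> V y -> V (x - y).
Proof. by move=> sV Vx Vy; apply: subspaceD => //; exact: subspaceN. Qed.

Lemma subspace_sum V (n : nat) (F : nat -> L) :
  lie_subspace V -> (forall i, V (F i)) -> V (\sum_(i < n) F i).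
Proof.
move=> sV VF; elim/big_ind: _ => [|x y|//]; first by case: sV.
exact: subspaceD.
Qed.

Lemma subspaceT : lie_subspace [set: L]. Proof. by []. Qed.

Lemma subspace0 : lie_subspace [set 0 : L].
Proof. by split=> // a x y -> ->; rewrite scaler0 addr0. Qed.

Lemma closed0 : closed [set 0 : L].
Proof.
move=> x /closure_decayP[y y0 xy]; apply: geom_decay_cst.
by apply: (eq_geom_decay _ xy) => n; rewrite (y0 n) subr0.
Qed.

Lemma closure_subspace V : lie_subspace V -> lie_subspace (closure V).
Proof.
move=> sV; split; first by apply: subset_closure; case: sV.
move=> a x y /closure_decayP[x' Vx' xx'] /closure_decayP[y' Vy' yy'].
apply/closure_decayP; exists (fun n => a *: x' n + y' n).
  by move=> n; apply: subspaceD => //; exact: subspaceZ.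
apply: (eq_geom_decay _ (geom_decayD (geom_decayZ a xx') yy')) => n.
by rewrite scalerBr opprD addrACA.
Qed.

Lemma lin_span_subspace A : lie_subspace (lin_span A).
Proof.
split=> [B [[]]//|a x y Ax Ay B [sB AB]].
by have [_] := sB; apply; [exact: Ax|exact: Ay].
Qed.

Lemma sub_lin_span A : A `<=` lin_span A.
Proof. exact: sub_smallest. Qed.

Lemma lin_span_min A V : lie_subspace V -> A `<=` V -> lin_span A `<=` V.
Proof. by move=> ? ?; exact: smallest_sub. Qed.

Lemma closed_span_subspace A : lie_subspace (closed_span A).
Proof. exact/closure_subspace/lin_span_subspace. Qed.

Lemma closed_closed_span A : closed (closed_span A).
Proof. exact: closed_closure. Qed.

Lemma sub_closed_span A : A `<=` closed_span A.
Proof. by move=> x Ax; apply: subset_closure; exact: sub_lin_span. Qed.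

Lemma closed_span_min A V : lie_subspace V -> closed V -> A `<=` V ->
  closed_span A `<=` V.
Proof.
move=> sV cV AV; rewrite (closure_id V).1 //.
by apply: closureS; exact: lin_span_min.
Qed.

Lemma subspace_preimage (M : banachLieType R) (f : L -> M) (W : set M) :
  (forall (a : R[i]) x y, f (a *: x + y) = a *: f x + f y) ->
  lie_subspace W -> lie_subspace (f @^-1` W).
Proof.
move=> lf [W0 WZ]; split=> [|a x y Wx Wy /=]; last by rewrite lf; exact: WZ.
by have /= := lf (-1) 0 0; rewrite !scaleN1r !addNr => ->.
Qed.

Lemma subspaceI V W : lie_subspace V -> lie_subspace W ->
  lie_subspace (V `&` W).
Proof.
move=> [V0 VZ] [W0 WZ]; split=> // a x y [Vx Wx] [Vy Wy].
by split; [exact: VZ|exact: WZ].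
Qed.

End Subspaces.

(** * Bounded homomorphisms *)

Section Homomorphisms.
Context {R : realType}.
Implicit Types (L M N : banachLieType R).

(** A predicate on bare functions, without density of the range: limits of exponential series,
    restrictions to subalgebras and factor maps between quotients all arise as bare functions. *)
Definition lie_hom L M (f : L -> M) :=
  [/\ forall (a : R[i]) x y, f (a *: x + y) = a *: f x + f y,
      forall x y, f (lie x y) = lie (f x) (f y) &
      bounded_operator f].

Lemma lie_homD L M (f : L -> M) x y : lie_hom f -> f (x + y) = f x + f y.
Proof. by case=> lf _ _; rewrite -[x]scale1r lf !scale1r. Qed.

Lemma lie_hom0 L M (f : L -> M) : lie_hom f -> f 0 = 0.
Proof. by case=> lf _ _; have /= := lf (-1) 0 0; rewrite !scaleN1r !addNr. Qed.

Lemma lie_homZ L M (f : L -> M) (a : R[i]) x : lie_hom f ->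
  f (a *: x) = a *: f x.
Proof.
by move=> hf; have [lf _ _] := hf; rewrite -[_ *: x]addr0 lf lie_hom0 ?addr0.
Qed.

Lemma lie_homB L M (f : L -> M) x y : lie_hom f -> f (x - y) = f x - f y.
Proof.
by move=> hf; rewrite lie_homD // -scaleN1r lie_homZ // scaleN1r.
Qed.

(** A nonzero vector forces the given constant to be nonnegative; if there is none, the constant 0
    works. *)
Lemma bounded_operator_ge0 L M (f : L -> M) : bounded_operator f ->
  exists2 k : R[i], 0 <= k & forall x, `|f x| <= k * `|x|.
Proof.
move=> [k kf]; have [[x x0]|h] := pselect (exists x : L, x != 0).
  exists k => //; have := le_trans (normr_ge0 _) (kf x).
  by rewrite pmulr_lge0 ?normr_gt0.
exists 0 => // x; have -> : x = 0.
  by apply/eqP; apply: contra_notT h => x0; exists x.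
by rewrite mul0r (le_trans (kf 0)) // normr0 mulr0.
Qed.

Lemma hom_decay L M (f : L -> M) (u : nat -> L) : lie_hom f ->
  geom_decay u -> geom_decay (fun n => f (u n)).
Proof.
move=> [_ _ /bounded_operator_ge0[k k0 kf]] hu.
exact: (geom_decay_le k0 hu).
Qed.

Lemma closed_preimage_hom L M (f : L -> M) (W : set M) : lie_hom f ->
  closed W -> closed (f @^-1` W).
Proof.
move=> hf cW x /closure_decayP[y Wy xy].
apply: (closed_decay cW Wy); apply: (eq_geom_decay _ (hom_decay hf xy)) => n.
by rewrite lie_homB.
Qed.

Lemma hom_closed_span L M (f : L -> M) (A : set L) (W : set M) : lie_hom f ->
  lie_subspace W -> closed W -> f @` A `<=` W -> f @` closed_span A `<=` W.
Proof.
move=> hf sW cW AW _ [x xA <-]; move: x xA; apply: closed_span_min.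
- by apply: subspace_preimage => //; case: hf.
- exact: closed_preimage_hom.
- by move=> x Ax; apply: AW; exists x.
Qed.

Lemma hom_image_subspace L M (f : L -> M) (V : set L) : lie_hom f ->
  lie_subspace V -> lie_subspace (f @` V).
Proof.
move=> hf [V0 VZ]; split; first by exists 0 => //; exact: lie_hom0.
move=> a _ _ [x Vx <-] [y Vy <-]; exists (a *: x + y); first exact: VZ.
by case: hf.
Qed.

Lemma hom_image_subalgebra L M (f : L -> M) (V : set L) : lie_hom f ->
  lie_subalgebra V -> lie_subalgebra (f @` V).
Proof.
move=> hf [sV VV]; split; first exact: hom_image_subspace.
move=> _ _ [x Vx <-] [y Vy <-]; exists (lie x y); first exact: VV.
by case: hf.
Qed.

Lemma hom_image_ideal_in L M (f : L -> M) (V W : set L) : lie_hom f ->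
  lie_ideal_in V W -> lie_ideal_in (f @` V) (f @` W).
Proof.
move=> hf [sV VW WV]; split; first exact: hom_image_subspace.
  exact: image_subset.
move=> _ _ [x Wx <-] [y Vy <-]; exists (lie x y); first exact: WV.
by case: hf.
Qed.

Lemma image_lin_span L M (f : L -> M) (A : set L) : lie_hom f ->
  f @` lin_span A = lin_span (f @` A).
Proof.
move=> hf; apply/seteqP; split.
  move=> _ [x xA <-]; move: x xA; apply: lin_span_min.
    apply: subspace_preimage; [by case: hf|exact: lin_span_subspace].
  by move=> x Ax; apply: sub_lin_span; exists x.
apply: lin_span_min; first exact/hom_image_subspace/lin_span_subspace.
by apply: image_subset; exact: sub_lin_span.
Qed.

Lemma image_derived L M (f : L -> M) (A : set L) : lie_hom f ->
  f @` derived A = derived (f @` A).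
Proof.
move=> hf; rewrite /derived image_lin_span //; congr lin_span.
apply/seteqP; split.
  move=> _ [_ [x Ax [y Ay <-]] <-]; have [_ -> _] := hf.
  by exists (f x); [exists x|exists (f y); [exists y|]].
move=> _ [_ [x Ax <-] [_ [y Ay <-] <-]]; have [_ <- _] := hf.
by exists (lie x y) => //; exists x => //; exists y.
Qed.

Lemma image_solvable L M (f : L -> M) (A : set L) : lie_hom f ->
  lie_solvable A -> lie_solvable (f @` A).
Proof.
move=> hf [n An]; exists n.
suff -> : iter n derived (f @` A) = f @` iter n derived A.
  by rewrite An image_set1 lie_hom0.
by elim: n {An} => //= n ->; rewrite image_derived.
Qed.

End Homomorphisms.

(** * Closedness of finite-dimensional subspaces *)

Section ClosedFiniteDim.
Context {R : realType}.

(** The real and imaginary parts inherit the Cauchy bound and converge in R, each with error c /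
    2^n; this is why the resulting constant is c + c. *)
Lemma complex_cauchy_decay (a : nat -> R[i]) (c : R[i]) : 0 <= c ->
  (forall n m, (n <= m)%N -> `|a n - a m| <= c * 2^-1 ^+ n) ->
  exists l, geom_decay (fun n => l - a n : R[i]^o).
Proof.
move=> c0 ha; have cE : c = (complex.Re c)%:C by rewrite RRe_real // ger0_real.
set d := complex.Re c in cE.
have d0 : 0 <= d by rewrite -lecR -cE.
have hE n : c * 2^-1 ^+ n = (d * 2^-1 ^+ n)%:C.
  by rewrite cE rmorphM /= -half_exprE.
have hd e : 0 < e -> exists n, d * 2^-1 ^+ n < e by exact: half_expr_ltR.
have [x hx] : exists x : R, forall n, `|x - complex.Re (a n)| <= d * 2^-1 ^+ n.
  apply: (@cauchy_bound_cvg R R^o) => // n m nm.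
  rewrite -raddfB -lecR -hE (le_trans _ (ha n m nm)) //.
  exact: normc_ge_Re.
have Im_ge (z : R[i]) : `|complex.Im z|%:C <= `|z|.
  have := normc_ge_Re (z * 'i%C); rewrite ReiNIm normrN normrM.
  by rewrite (normc_def 'i%C) /= expr0n expr1n add0r sqrtr1 mulr1.
have [y hy] : exists y : R, forall n, `|y - complex.Im (a n)| <= d * 2^-1 ^+ n.
  apply: (@cauchy_bound_cvg R R^o) => // n m nm.
  rewrite -raddfB -lecR -hE (le_trans _ (ha n m nm)) //.
  exact: Im_ge.
exists (x +i* y), (c + c) => n.
rewrite [a n]complexE [x +i* y]complexE /= opprD addrACA -mulrBr -!rmorphB.
rewrite (le_trans (ler_normD _ _)) // normrM mulrDl hE lerD //.
  by rewrite normc_def /= expr0n addr0 sqrtr_sqr lecR.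
have -> : `|'i%C : R[i]| = 1 by rewrite normc_def /= expr0n expr1n add0r sqrtr1.
by rewrite mul1r normc_def /= expr0n addr0 sqrtr_sqr lecR.
Qed.

Context {L : banachLieType R}.
Implicit Types (V : set L) (x y : L).

Definition line x : set L := [set a *: x | a in [set: R[i]]].

Lemma line_subspace x : lie_subspace (line x).
Proof.
split; first by exists 0; rewrite ?scale0r.
move=> a _ _ [b _ <-] [c _ <-]; exists (a * b + c) => //.
by rewrite scalerDl scalerA.
Qed.

Lemma mem_line x : line x x.
Proof. by exists 1; rewrite ?scale1r. Qed.

Lemma lin_span1 x : lin_span [set x] = line x.
Proof.
apply/seteqP; split.
  apply: lin_span_min; first exact: line_subspace.
  by move=> _ ->; exact: mem_line.
move=> _ [a _ <-]; apply: (@subspaceZ _ _ (lin_span [set x])).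
  exact: lin_span_subspace.
exact: (@sub_lin_span _ _ [set x]).
Qed.

Definition sum_set V W : set L := [set x + y | x in V & y in W].

Lemma sum_subspace V W : lie_subspace V -> lie_subspace W ->
  lie_subspace (sum_set V W).
Proof.
move=> sV sW; split.
  by exists 0; [case: sV|exists 0; [case: sW|rewrite addr0]].
move=> a _ _ [v Vv [w Ww <-]] [v' Vv' [w' Ww' <-]].
exists (a *: v + v'); first by case: sV => _; apply.
exists (a *: w + w'); first by case: sW => _; apply.
by rewrite scalerDr addrACA.
Qed.

Lemma sub_suml V W : lie_subspace W -> V `<=` sum_set V W.
Proof. by case=> W0 _ v Vv; exists v => //; exists 0; rewrite ?addr0. Qed.

Lemma sub_sumr V W : lie_subspace V -> W `<=` sum_set V W.
Proof. by case=> V0 _ v Vv; exists 0 => //; exists v; rewrite ?add0r. Qed.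

Lemma sum_min V W U : lie_subspace U -> V `<=` U -> W `<=` U ->
  sum_set V W `<=` U.
Proof.
by move=> sU VU WU _ [v /VU Uv [w /WU Uw <-]]; exact: subspaceD.
Qed.

(* The distance d > 0 from x to V bounds the coefficient of x in v + a x, so
   the coefficients of a convergent sequence are Cauchy. *)
Lemma closed_sum_line V x : lie_subspace V -> closed V ->
  closed (sum_set V (line x)).
Proof.
move=> sV cV; have [Vx|nVx] := pselect (V x).
  suff -> : sum_set V (line x) = V by [].
  apply/seteqP; split; last exact/sub_suml/line_subspace.
  by apply: sum_min => // _ [a _ <-]; exact: subspaceZ.
have [d d0 hd] : exists2 d : R[i], 0 < d & forall v, V v -> d <= `|x - v|.
  have : nbhs x (~` V).
    by apply: open_nbhs_nbhs; split=> //; exact: closed_openC.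
  move=> /nbhs_ballP[d /= d0 dV]; exists d => // v Vv.
  rewrite real_leNgt ?(gtr0_real d0) ?normr_real //.
  by apply/negP => xv; apply: (dV v) => //; exact/ball_norm_lt.
have key : forall v (a : R[i]), V v -> `|a| * d <= `|v + a *: x|.
  move=> v a Vv; have [->|a0] := eqVneq a 0; first by rewrite normr0 mul0r.
  rewrite mulrC -ler_pdivlMr ?normr_gt0 // mulrC -normfV -normrZ scalerDr.
  rewrite scalerK // addrC -[_ *: v]opprK; apply: hd.
  by apply: subspaceN => //; exact: subspaceZ.
move=> y /closure_decayP[z Vz [c yz]].
have /boolp.choice[a ha] : forall n, exists a, V (z n - a *: x).
  move=> n; have [v Vv [_ [a _ <-] <-]] := Vz n.
  by exists a; rewrite addrK.
have c0 := geom_decay_c (u := fun n => y - z n) yz.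
have hcd : 0 <= (c + c) / d by rewrite divr_ge0 ?addr_ge0 ?(ltW d0).
have [n m nm|l al] := complex_cauchy_decay (a := a) hcd.
  rewrite mulrAC ler_pdivlMr //.
  have := key ((z n - a n *: x) - (z m - a m *: x)) (a n - a m).
  have -> : z n - a n *: x - (z m - a m *: x) + (a n - a m) *: x = z n - z m.
    rewrite scalerBl.
    have -> : z n - a n *: x - (z m - a m *: x) =
        z n - z m - (a n *: x - a m *: x) by rewrite !opprD addrACA.
    by rewrite subrK.
  move=> h; apply: (le_trans (h _)); first exact: subspaceB.
  rewrite -(subrKA y) (le_trans (ler_normD _ _)) // distrC mulrDl addrC.
  rewrite lerD // (le_trans (yz m)) // ler_wpM2l //.
  by rewrite ler_wiXn2l ?invr_ge0 ?invf_le1 ?ler1n.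
exists (y - l *: x); last by exists (l *: x); [exists l|rewrite subrK].
apply: (@closed_decay _ _ V (fun n => z n - a n *: x)) => //.
have alx : geom_decay (fun n => (l - a n) *: x).
  apply: (geom_decay_le (normr_ge0 x) al) => n.
  by rewrite normrZ mulrC.
have yz' : geom_decay (fun n => y - z n) by exists c.
apply: (eq_geom_decay _ (geom_decayD yz' (geom_decayN alx))) => n /=.
by rewrite scalerBl !opprD addrACA.
Qed.

Lemma lin_span_nil : lin_span [set` [::] : seq L] = [set 0].
Proof.
apply/seteqP; split; first by apply: lin_span_min => //; exact: subspace0.
by move=> _ ->; case: (lin_span_subspace [set` [::] : seq L]).
Qed.

Lemma lin_span_cons x (s : seq L) :
  lin_span [set` x :: s] = sum_set (lin_span [set` s]) (line x).
Proof.
have sS := lin_span_subspace [set` s]; have sX := line_subspace x.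
apply/seteqP; split.
  apply: lin_span_min; first exact: sum_subspace.
  move=> y /=; rewrite inE => /predU1P[->|ys].
    by apply: sub_sumr => //; exact: mem_line.
  by apply: sub_suml => //; exact: sub_lin_span.
have sXS := lin_span_subspace [set` x :: s].
apply: sum_min => //.
  apply: lin_span_min => // y /= ys; apply: sub_lin_span.
  by rewrite /= inE ys orbT.
rewrite -lin_span1; apply: lin_span_min => // _ ->; apply: sub_lin_span.
by rewrite /= mem_head.
Qed.

Lemma closed_finite_span (s : seq L) : closed (lin_span [set` s]).
Proof.
elim: s => [|x s IH]; first by rewrite lin_span_nil; exact: closed0.
rewrite lin_span_cons; apply: closed_sum_line => //.
exact: lin_span_subspace.
Qed.

End ClosedFiniteDim.

(** * Inner automorphisms *)

Section Exponential.
Context {R : realType} {L : banachLieType R}.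
Implicit Types (x y z : L) (E : L -> L).

Definition exp_term E n x : L := (n`!%:R : R[i])^-1 *: iter n E x.
Definition exp_sum E n x : L := \sum_(k < n) exp_term E k x.

Definition linear_bound (r : R[i]) E :=
  (forall (a : R[i]) x y, E (a *: x + y) = a *: E x + E y) /\
  (forall x, `|E x| <= r * `|x|).

(* The error bound determines phi as the sum of the exponential series, since
   r < 1. *)
Definition is_exp (r : R[i]) E (phi : L -> L) :=
  forall x n, `|phi x - exp_sum E n x| <= 2 * r ^+ n * `|x|.

Section Bounds.
Variables (r : R[i]) (E : L -> L).
Hypotheses (r0 : 0 <= r) (r8 : r <= 8^-1) (hE : linear_bound r E).

Lemma iter_linear n (a : R[i]) x y :
  iter n E (a *: x + y) = a *: iter n E x + iter n E y.
Proof. by elim: n => //= n ->; case: hE => ->. Qed.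

Lemma iterZ n (a : R[i]) x : iter n E (a *: x) = a *: iter n E x.
Proof.
have := iter_linear n (-1) 0 0; rewrite !scaleN1r !addNr => i0.
by rewrite -[a *: x]addr0 iter_linear i0 addr0.
Qed.

Lemma iter_norm n x : `|iter n E x| <= r ^+ n * `|x|.
Proof.
elim: n => [|n IH] /=; first by rewrite expr0 mul1r.
have [_ /(_ (iter n E x)) h] := hE.
by rewrite (le_trans h) // exprS -mulrA ler_wpM2l.
Qed.

Lemma exp_term_norm n x : `|exp_term E n x| <= r ^+ n * `|x|.
Proof.
rewrite normrZ normfV normr_nat (le_trans _ (iter_norm n x)) //.
by rewrite ler_piMl // invf_le1 ?ler1n ?ltr0n ?fact_gt0.
Qed.

Lemma exp_term_linear n (a : R[i]) x y :
  exp_term E n (a *: x + y) = a *: exp_term E n x + exp_term E n y.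
Proof. by rewrite /exp_term iter_linear scalerDr !scalerA mulrC. Qed.

Lemma exp_sum_linear n (a : R[i]) x y :
  exp_sum E n (a *: x + y) = a *: exp_sum E n x + exp_sum E n y.
Proof.
rewrite /exp_sum scaler_sumr -big_split /=.
by apply: eq_bigr => k _; exact: exp_term_linear.
Qed.

Lemma exp_sum_tail n k x :
  `|exp_sum E (n + k) x - exp_sum E n x| <= 2 * r ^+ n * `|x|.
Proof.
(* The sharper bound telescopes: the next term r^m |x| fits into 2 (r^m - r^(m+1)) |x| because 2 r
   <= 1. *)
suff h : `|exp_sum E (n + k) x - exp_sum E n x| <=
    2 * r ^+ n * `|x| - 2 * r ^+ (n + k) * `|x|.
  by rewrite (le_trans h) // gerBl !mulr_ge0 ?exprn_ge0.
elim: k => [|k IH]; first by rewrite addn0 !subrr normr0.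
rewrite addnS /exp_sum big_ord_recr /= -/(exp_sum _ _ _) addrAC.
rewrite (le_trans (ler_normD _ _)) //.
rewrite (le_trans (lerD IH (exp_term_norm _ _))) //.
rewrite -addrA lerD2l addrC -subr_ge0.
have -> : - (2 * r ^+ (n + k).+1 * `|x|) -
  (r ^+ (n + k) * `|x| - 2 * r ^+ (n + k) * `|x|) =
   r ^+ (n + k) * `|x| * (1 - 2 * r).
  by rewrite exprS; ring.
rewrite !mulr_ge0 ?exprn_ge0 // subr_ge0.
rewrite (le_trans (ler_wpM2l _ r8)) // ler_pdivrMr // mul1r.
by rewrite ler_nat.
Qed.

Lemma geom_decay_pow (u : nat -> L) (c : R[i]) :
  0 <= c -> (forall n, `|u n| <= c * r ^+ n) -> geom_decay u.
Proof.
move=> c0 h; exists c => n; rewrite (le_trans (h n)) //.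
rewrite ler_wpM2l // lerXn2r ?nnegrE ?invr_ge0 //.
by rewrite (le_trans r8) // lef_pV2 ?posrE // ler_nat.
Qed.

Lemma exp_exists : exists phi, is_exp r E phi.
Proof.
suff /boolp.choice[phi h] : forall x, exists y, forall n,
    `|y - exp_sum E n x| <= 2 * r ^+ n * `|x| by exists phi.
move=> x; pose ys n := exp_sum E n x.
have tail n m : (n <= m)%N -> `|ys n - ys m| <= 2 * r ^+ n * `|x|.
  by move=> nm; rewrite distrC -(subnKC nm) exp_sum_tail.
have slt (e : R[i]) : 0 < e -> exists n, 2 * r ^+ n * `|x| < e.
  have x0 : 0 <= 2 * `|x| by rewrite mulr_ge0.
  move=> /(half_expr_lt x0)[n ne]; exists n; apply: le_lt_trans ne.
  rewrite mulrAC ler_wpM2l // lerXn2r ?nnegrE ?invr_ge0 //.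
  by rewrite (le_trans r8) // lef_pV2 ?posrE // ler_nat.
exact: (cauchy_bound_cvg slt tail).
Qed.

Variable phi : L -> L.
Hypothesis hphi : is_exp r E phi.

Lemma exp_decay x : geom_decay (fun n => phi x - exp_sum E n x).
Proof.
apply: (@geom_decay_pow _ (2 * `|x|)); first by rewrite mulr_ge0.
by move=> n; rewrite mulrAC; exact: hphi.
Qed.

Lemma exp_sum_norm n x : `|exp_sum E n x| <= 2 * `|x|.
Proof.
by have := exp_sum_tail 0 n x; rewrite /exp_sum big_ord0 subr0 expr0 mulr1.
Qed.

Lemma exp_norm x : `|phi x| <= 2 * `|x|.
Proof.
by have := hphi x 0; rewrite /exp_sum big_ord0 subr0 expr0 mulr1.
Qed.

Lemma exp_linear (a : R[i]) x y : phi (a *: x + y) = a *: phi x + phi y.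
Proof.
apply/subr0_eq/geom_decay_cst.
have h := geom_decayD (exp_decay (a *: x + y))
  (geom_decayN (geom_decayD (geom_decayZ a (exp_decay x)) (exp_decay y))).
apply: (eq_geom_decay _ h) => n /=.
rewrite exp_sum_linear scalerBr.
by rewrite [X in _ - X]addrACA -opprD opprB subrKA.
Qed.

Lemma exp_stable (W : set L) : lie_subspace W -> closed W ->
  (forall x, W x -> W (E x)) -> forall x, W x -> W (phi x).
Proof.
move=> sW cW WE x Wx.
apply: (@closed_decay _ _ W (fun n => exp_sum E n x) _ cW _ (exp_decay x)) => n.
apply: (@subspace_sum _ _ W n (fun k => exp_term E k x)) => // k.
apply: subspaceZ => //.
by elim: k => //= k; exact: WE.
Qed.

(** The error bound at n = 2. Being quadratic in r, it still tends to 0 after division by the time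
    parameter. *)
Lemma exp_first_order x : `|phi x - x - E x| <= 2 * r ^+ 2 * `|x|.
Proof.
have := hphi x 2; rewrite /exp_sum big_ord_recr big_ord1 /= /exp_term /=.
by rewrite fact0 invr1 !scale1r opprD addrA.
Qed.

End Bounds.

(** * Cauchy products *)

Section DoubleSum.
Variables (w : nat -> nat -> L) (c : R[i]).
Hypothesis hw : forall k l, `|w k l| <= c * 8^-1 ^+ (k + l).

Lemma triangle_sum n : \sum_(k < n) \sum_(l < n - k) w k l =
  \sum_(m < n) \sum_(k < m.+1) w k (m - k)%N.
Proof.
(* Passing from n to n + 1 extends each row k by its entry on the antidiagonal n, and adds the row
   n, which has a single entry. *)
elim: n => [|n IH]; first by rewrite !big_ord0.
rewrite [RHS]big_ord_recr /= -IH [LHS]big_ord_recr /=.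
rewrite [in RHS]big_ord_recr /= addrA; congr (_ + _); last first.
  by rewrite subSnn big_ord1 subnn.
rewrite -big_split /=; apply: eq_bigr => k _.
by rewrite subSn ?big_ord_recr // ltnW.
Qed.

(* Cauchy product: the n ^ 2 terms above the antidiagonal are each bounded by
   c / 8 ^ n, and n ^ 2 / 8 ^ n <= 1 / 2 ^ n. *)
Lemma square_sum_decay : geom_decay (fun n =>
  \sum_(k < n) \sum_(l < n) w k l - \sum_(m < n) \sum_(k < m.+1) w k (m - k)%N).
Proof.
have c0 : 0 <= c.
  by have := hw 0 0; rewrite expr0 mulr1; exact: le_trans.
exists c => n; rewrite -triangle_sum -sumrB.
have bnd : \sum_(k < n) \sum_(l < n) c * 8^-1 ^+ n <= c * 2^-1 ^+ n.
  rewrite !sumr_const !card_ord -mulrnA -[_ *+ (n * n)]mulr_natr -mulrA.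
  rewrite ler_wpM2l //.
  have -> : 8^-1 ^+ n = 2^-1 ^+ n * (2^-1 ^+ n * 2^-1 ^+ n) :> R[i].
    by rewrite -!exprMn; congr (_ ^+ _); field.
  rewrite -mulrA ler_piMr ?exprn_ge0 ?invr_ge0 //.
  rewrite -exprMn -invfM exprVn mulrC ler_pdivrMr ?exprn_gt0 ?mulr_gt0 // mul1r.
  rewrite exprMn -!natrX -natrM ler_nat leq_mul // ltnW //; exact: ltn_expl.
apply: le_trans bnd; apply: (le_trans (ler_norm_sum _ _ _)).
apply: ler_sum => k _.
have kn : (n - k <= n)%N by rewrite leq_subr.
have split (U : zmodType) (G : nat -> U) : \sum_(l < n) G l =
    \sum_(l < n - k) G l + \sum_(n - k <= l < n) G l.
  by rewrite -!(big_mkord predT G) /= -big_cat_nat.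
rewrite (split _ (w k)) addrAC subrr add0r.
rewrite (le_trans (ler_norm_sum _ _ _)) //.
rewrite (split _ (fun=> c * 8^-1 ^+ n)) ler_wpDl //.
  by apply: sumr_ge0 => l _; rewrite mulr_ge0 ?exprn_ge0 ?invr_ge0.
rewrite !big_nat; apply: ler_sum => l /andP[nkl ln].
rewrite (le_trans (hw _ _)) // ler_wpM2l //.
apply: ler_wiXn2l; rewrite ?invr_ge0 ?invf_le1 ?ler1n //.
by rewrite -leq_subLR.
Qed.

End DoubleSum.
End Exponential.

Section LieZ.
Context {R : realType} {L : banachLieType R}.
Implicit Types (x y z : L).

Lemma lieZr (a : R[i]) x y : lie x (a *: y) = a *: lie x y.
Proof.
have h : lie x 0 = 0.
  by apply: (addIr (lie x 0)); rewrite -lieDr addr0 add0r.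
by rewrite -[a *: y]addr0 lie_linearr h addr0.
Qed.

Lemma lieZl (a : R[i]) x y : lie (a *: x) y = a *: lie x y.
Proof. by rewrite lieC lieZr -scalerN -lieC. Qed.

Lemma lie0r x : lie x 0 = 0.
Proof. by rewrite -(scale0r x) lieZr !scale0r. Qed.

Lemma lie0l x : lie 0 x = 0.
Proof. by rewrite lieC lie0r oppr0. Qed.

Lemma lie_sumr (I : Type) (s : seq I) (P : pred I) (F : I -> L) x :
  lie x (\sum_(i <- s | P i) F i) = \sum_(i <- s | P i) lie x (F i).
Proof. by apply: (big_morph (lie x)) => [y z|]; rewrite ?lieDr ?lie0r. Qed.

Lemma lie_suml (I : Type) (s : seq I) (P : pred I) (F : I -> L) x :
  lie (\sum_(i <- s | P i) F i) x = \sum_(i <- s | P i) lie (F i) x.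
Proof. by apply: (big_morph (lie^~ x)) => [y z|]; rewrite ?lieDl ?lie0l. Qed.

End LieZ.

(** * Exponentials of derivations are automorphisms *)

Section ExpAutomorphism.
Context {R : realType} {L : banachLieType R}.
Implicit Types (x y z : L).
Variables (r : R[i]) (E : L -> L).
Hypotheses (r0 : 0 <= r) (r8 : r <= 8^-1) (hE : linear_bound r E).

Let E' x := - E x.

Lemma linear_boundN : linear_bound r E'.
Proof.
have [lE nE] := hE; split=> [a x y|x]; last by rewrite normrN.
by rewrite /E' lE opprD scalerN.
Qed.

Lemma iterN n x : iter n E' x = (-1) ^+ n *: iter n E x.
Proof.
elim: n => [|n IH] /=; first by rewrite expr0 scale1r.
rewrite IH /E' exprS mulN1r scaleNr; congr (- _).
by rewrite -(iterZ hE 1).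
Qed.

(* Binomial formula for (1 - 1) ^ m, in the Cauchy product of exp E and
   exp (- E). *)
Lemma exp_expN_term m x :
  \sum_(k < m.+1) exp_term E k (exp_term E' (m - k) x) =
  if m is 0 then x else 0.
Proof.
transitivity (((m`!%:R)^-1 * (-1 + 1) ^+ m : R[i]) *: iter m E x); last first.
  rewrite addNr; case: m => [|m]; last by rewrite expr0n mulr0 scale0r.
  by rewrite fact0 invr1 expr0 mulr1 scale1r.
rewrite exprDn mulr_sumr scaler_suml; apply: eq_bigr => -[k /= km] _.
rewrite /exp_term iterN !(iterZ hE) -iterD subnKC // !scalerA; congr (_ *: _).
rewrite expr1n mulr1 -(bin_fact (ltnSE km)) !natrM -[_ *+ _]mulr_natr; field.
by rewrite !pnatr_eq0 -!lt0n !fact_gt0 bin_gt0.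
Qed.

Lemma exp_cancel phi psi : is_exp r E phi -> is_exp r E' psi ->
  cancel psi phi.
Proof.
move=> hphi hpsi x; apply/subr0_eq/geom_decay_cst.
have hN := linear_boundN.
have hw k l : `|exp_term E k (exp_term E' l x)| <= `|x| * 8^-1 ^+ (k + l).
  rewrite (le_trans (exp_term_norm r0 hE _ _)) //.
  rewrite (le_trans (ler_wpM2l _ (exp_term_norm r0 hN _ _))) ?exprn_ge0 //.
  rewrite mulrA -exprD mulrC ler_wpM2l //.
  by rewrite lerXn2r ?nnegrE ?invr_ge0.
(* phi (psi x) - x is telescoped through the partial sum at psi x, the double sum over the square
   and the sum over antidiagonals. The last one equals x except for n = 0, where it is empty; [d4]
   absorbs this exception. *)
have d1 := square_sum_decay hw.
have d2 := exp_decay r0 r8 hphi (psi x).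
have d3 : geom_decay (fun n => exp_sum E n (psi x - exp_sum E' n x)).
  apply: (geom_decay_le (_ : 0 <= 2) (exp_decay r0 r8 hpsi x)) => // n.
  exact: (exp_sum_norm r0 r8 hE).
have d4 : geom_decay (fun n => (if n is 0 then 0 else x) - x).
  by exists `|x| => -[|n]; rewrite ?sub0r ?normrN ?expr0 ?mulr1 // subrr
    normr0 mulr_ge0 ?exprn_ge0 ?invr_ge0.
apply: (eq_geom_decay _ (geom_decayD (geom_decayD d2 d3) (geom_decayD d1 d4))).
move=> n /=.
have -> : exp_sum E n (psi x - exp_sum E' n x) =
    exp_sum E n (psi x) - exp_sum E n (exp_sum E' n x).
  rewrite addrC -scaleN1r (exp_sum_linear hE) scaleN1r addrC.
  by [].
have -> : \sum_(k < n) \sum_(l < n) exp_term E k (exp_term E' l x) =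
    exp_sum E n (exp_sum E' n x).
  apply: eq_bigr => k _; rewrite /exp_sum.
  rewrite (big_morph (exp_term E k) (id1 := 0) (op1 := +%R)) //.
    by move=> y z; rewrite -[y]scale1r (exp_term_linear hE) !scale1r.
  by rewrite -(scale0r 0) /exp_term (iterZ hE) !(scale0r, scaler0).
have -> : \sum_(m < n) \sum_(k < m.+1) exp_term E k (exp_term E' (m - k) x) =
    if n is 0 then 0 else x.
  under eq_bigr do rewrite exp_expN_term.
  by case: n => [|n]; rewrite ?big_ord0 // big_ord_recl big1 ?addr0.
by rewrite subrKA subrKA subrKA.
Qed.

Hypothesis E_derivation : forall x y, E (lie x y) = lie (E x) y + lie x (E y).

Lemma exp_termS n x : E (exp_term E n x) = n.+1%:R *: exp_term E n.+1 x.
Proof.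
rewrite /exp_term (iterZ hE 1 : forall a y, E (a *: y) = a *: E y) /= scalerA.
congr (_ *: _); rewrite factS natrM; field.
by rewrite nat1r !pnatr_eq0 -!lt0n fact_gt0.
Qed.

Lemma exp_term_lie m x y :
  \sum_(k < m.+1) lie (exp_term E k x) (exp_term E (m - k) y) =
  exp_term E m (lie x y).
Proof.
have E0 : E 0 = 0 by have := iterZ hE 1 0 0; rewrite /= !scale0r.
have ED u v : E (u + v) = E u + E v.
  by have [lE _] := hE; have := lE 1 u v; rewrite !scale1r.
elim: m => [|m IH].
  by rewrite big_ord1 /exp_term /= fact0 invr1 !scale1r.
(* Leibniz rule, multiplied by m + 1 to clear the denominator: applying E to the case m raises one
   of the two indices, and the weights k and m + 1 - k that appear add up to m + 1. *)
have m0 : m.+1%:R != 0 :> R[i] by rewrite pnatr_eq0.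
apply: (scalerI m0); rewrite -exp_termS -IH.
rewrite (big_morph E ED E0) /=.
under [RHS]eq_bigr do
  rewrite E_derivation !exp_termS lieZl [lie _ (_.+1%:R *: _)]lieZr.
rewrite big_split /=.
have -> : \sum_(k < m.+1)
    k.+1%:R *: lie (exp_term E k.+1 x) (exp_term E (m - k) y)
  = \sum_(k < m.+2) k%:R *: lie (exp_term E k x) (exp_term E (m.+1 - k) y).
  by rewrite [RHS]big_ord_recl scale0r add0r.
have -> : \sum_(k < m.+1) (m - k).+1%:R *:
    lie (exp_term E k x) (exp_term E (m - k).+1 y)
  = \sum_(k < m.+2)
    (m.+1 - k)%:R *: lie (exp_term E k x) (exp_term E (m.+1 - k) y).
  rewrite [RHS]big_ord_recr /= subnn scale0r addr0.
  by apply: eq_bigr => -[k /= km] _; rewrite subSn.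
rewrite -big_split scaler_sumr /=; apply: eq_bigr => -[k /= km] _.
by rewrite -scalerDl -natrD subnKC.
Qed.

Lemma exp_lie phi x y : is_exp r E phi -> phi (lie x y) = lie (phi x) (phi y).
Proof.
move=> hphi; apply/subr0_eq/geom_decay_cst.
have [t t0 ht] := @lie_bounded R L.
have hw k l : `|lie (exp_term E k x) (exp_term E l y)| <=
    t * `|x| * `|y| * 8^-1 ^+ (k + l).
  rewrite (le_trans (ht _ _)) // exprD.
  have -> : t * `|x| * `|y| * (8^-1 ^+ k * 8^-1 ^+ l) =
    t * (8^-1 ^+ k * `|x|) * (8^-1 ^+ l * `|y|) by ring.
  have h n z : `|exp_term E n z| <= 8^-1 ^+ n * `|z|.
    rewrite (le_trans (exp_term_norm r0 hE _ _)) // ler_wpM2r //.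
    by rewrite lerXn2r ?nnegrE ?invr_ge0.
  by rewrite ler_pM ?mulr_ge0 ?ler_wpM2l ?(ltW t0).
have d1 := square_sum_decay hw.
have d2 := exp_decay r0 r8 hphi (lie x y).
have d3 : geom_decay (fun n => lie (phi x) (phi y - exp_sum E n y)).
  have tx0 : 0 <= t * `|phi x| by rewrite mulr_ge0 // ltW.
  by apply: (geom_decay_le tx0 (exp_decay r0 r8 hphi y)) => n; exact: ht.
have d4 : geom_decay (fun n => lie (phi x - exp_sum E n x) (exp_sum E n y)).
  apply: (geom_decay_le (_ : 0 <= t * (2 * `|y|)) (exp_decay r0 r8 hphi x)).
    by rewrite !mulr_ge0 // ltW.
  move=> n; rewrite (le_trans (ht _ _)) // -!mulrA ler_pM2l // mulrC.
  by rewrite mulrA ler_wpM2r // (exp_sum_norm r0 r8 hE).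
have h := geom_decayD d2 (geom_decayN (geom_decayD (geom_decayD d3 d4) d1)).
apply: (eq_geom_decay _ h) => n /=.
have -> : \sum_(k < n) \sum_(l < n) lie (exp_term E k x) (exp_term E l y) =
    lie (exp_sum E n x) (exp_sum E n y).
  by rewrite /exp_sum lie_suml; apply: eq_bigr => k _; rewrite lie_sumr.
have -> : \sum_(m < n) \sum_(k < m.+1)
    lie (exp_term E k x) (exp_term E (m - k) y)
   = exp_sum E n (lie x y).
  by apply: eq_bigr => m _; rewrite exp_term_lie.
rewrite lieDr lieDl lieNr lieNl subrKA subrKA.
by rewrite opprB subrKA.
Qed.

End ExpAutomorphism.

Section InnerAutomorphisms.
Context {R : realType} {L : banachLieType R}.
Implicit Types (x y z a : L).

Definition lie_iso_pair (M N : banachLieType R) (f : M -> N) (g : N -> M) :=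
  [/\ lie_hom f, lie_hom g, cancel f g & cancel g f].

(** [phi n] and [psi n] are the exponentials of t ad a and - t ad a for times t tending to 0, and
    [s n] is 1 / t, so that the last clause is differentiation at t = 0. The invariance clause makes
    them restrict to automorphisms of an ideal, as the finite-dimensional case requires. *)
Lemma exp_ad_exists a v : exists (phi psi : nat -> L -> L) (s : nat -> R[i]),
  [/\ forall n, lie_iso_pair (phi n) (psi n),
      forall n (W : set L), lie_subspace W -> closed W ->
        (forall x, W x -> W (lie a x)) ->
        (forall x, W x -> W (phi n x)) /\ (forall x, W x -> W (psi n x)) &
      geom_decay (fun n => s n *: (phi n v - v) - lie a v)].
Proof.
have [t t0 ht] := @lie_bounded R L.
pose K := t * `|a|; have K0 : 0 <= K by rewrite mulr_ge0 // ltW.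
have K1 : 0 < 8 * (K + 1) by rewrite mulr_gt0 // ltr_wpDl.
(* K bounds ad a, and K + 1 is nonzero even if a = 0. The operator tau ad a is then bounded by 2^-n
   / 8, which is [r n]. *)
pose tau n : R[i] := 2^-1 ^+ n / (8 * (K + 1)).
have h0 n : 0 < 2^-1 ^+ n :> R[i] by rewrite exprn_gt0 // invr_gt0.
have tau0 n : 0 < tau n by rewrite divr_gt0.
pose r n : R[i] := 2^-1 ^+ n * 8^-1.
have r0 n : 0 <= r n by rewrite mulr_ge0 ?invr_ge0 // ltW.
have r8 n : r n <= 8^-1.
  rewrite ler_piMl ?invr_ge0 // exprn_ile1 ?invr_ge0 //.
  by rewrite invf_le1 ?ler1n.
pose E n x := tau n *: lie a x.
have hE n : linear_bound (r n) (E n).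
  split=> [b x y|x]; first by rewrite /E lie_linearr scalerDr !scalerA mulrC.
  rewrite normrZ gtr0_norm // (le_trans (ler_wpM2l (ltW (tau0 n)) (ht a x))) //.
  rewrite mulrA ler_wpM2r // -/K /tau /r -mulrA ler_pM2l //.
  by rewrite invfM -mulrA ler_piMr ?invr_ge0 // mulrC ler_pdivrMr
    ?mul1r ?lerDl // ltr_wpDl.
have dE n x y : E n (lie x y) = lie (E n x) y + lie x (E n y).
  rewrite /E lieZl lieZr -scalerDr; congr (_ *: _).
  have /eqP := lie_jacobi a x y; rewrite -addrA addr_eq0 => /eqP ->.
  by rewrite (lieC y (lie a x)) (lieC y a) lieNr opprD !opprK addrC.
have dE' n x y : - E n (lie x y) = lie (- E n x) y + lie x (- E n y).
  by rewrite dE lieNl lieNr opprD.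
have /boolp.choice[phi hphi] n := exp_exists (r0 n) (r8 n) (hE n).
have /boolp.choice[psi hpsi] n :=
  exp_exists (r0 n) (r8 n) (linear_boundN (hE n)).
exists phi, psi, (fun n => (tau n)^-1); split.
- move=> n; split.
  + split; [exact: (exp_linear (r0 n) (r8 n) (hE n) (hphi n))| |].
      by move=> x y; exact: (exp_lie (r0 n) (r8 n) (hE n) (dE n) _ _ (hphi n)).
    by exists 2 => x; exact: (exp_norm (hphi n)).
  + have hN := linear_boundN (hE n).
    split; [exact: (exp_linear (r0 n) (r8 n) hN (hpsi n))| |].
      by move=> x y; exact: (exp_lie (r0 n) (r8 n) hN (dE' n) _ _ (hpsi n)).
    by exists 2 => x; exact: (exp_norm (hpsi n)).
  + have hN := linear_boundN (hE n).
    apply: (exp_cancel (r0 n) (r8 n) hN (hpsi n)).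
    have -> : (fun x => - - E n x) = E n; last exact: hphi.
    by apply/funext => x; rewrite opprK.
  + exact: (exp_cancel (r0 n) (r8 n) (hE n) (hphi n) (hpsi n)).
- move=> n W sW cW Wa; split.
    apply: (exp_stable (r0 n) (r8 n) (hphi n) sW cW) => x Wx.
    by apply: subspaceZ => //; exact: Wa.
  apply: (exp_stable (r0 n) (r8 n) (hpsi n) sW cW) => x Wx.
  by apply: subspaceN => //; apply: subspaceZ => //; exact: Wa.
(* Dividing the first-order error 2 r^2 |v| by tau gives (K + 1) |v| 2^-n / 4. *)
- exists ((K + 1) * `|v|) => n.
  have -> : (tau n)^-1 *: (phi n v - v) - lie a v =
      (tau n)^-1 *: (phi n v - v - E n v).
    by rewrite [RHS]scalerBr /E scalerA mulVf ?scale1r // gt_eqF.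
  rewrite normrZ gtr0_norm ?invr_gt0 // ler_pdivrMl //.
  rewrite (le_trans (exp_first_order (hphi n) v)) //.
  rewrite [leRHS](_ : _ = 2^-1 ^+ n * 2^-1 ^+ n / 8 * `|v|); last first.
    by rewrite /tau; field; rewrite gt_eqF // ltr_wpDl.
  rewrite ler_wpM2r // [leLHS](_ : _ = 2^-1 ^+ n * 2^-1 ^+ n / 8 * 4^-1).
    rewrite ler_piMr ?invf_le1 ?ler1n // !mulr_ge0 ?invr_ge0 //; exact: ltW.
  by rewrite /r; field.
Qed.

End InnerAutomorphisms.

(** * Subideals and superpositions *)

Section LieSubsetTheory.
Context {R : realType}.
Implicit Types (L M : banachLieType R).

Lemma ideal_in_subalgebra L (A B : set L) :
  lie_ideal_in A B -> lie_subalgebra A.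
Proof. by case=> sA AB BA; split=> // x y /AB Bx Ay; exact: BA. Qed.

Lemma subideal_subalgebra L (I : set L) : lie_subideal I -> lie_subalgebra I.
Proof. by case=> n [J [<- _ sJ _]]; exact: sJ. Qed.

Lemma subidealT L : lie_subideal [set: L].
Proof. by exists 0, (fun=> setT); split. Qed.

Lemma ideal_in_subideal L (A I : set L) :
  lie_subideal I -> lie_ideal_in A I -> lie_subideal A.
Proof.
move=> [n [J [J0 Jn sJ iJ]]] AI.
exists n.+1, (fun k => if k is k'.+1 then J k' else A); split=> //.
  by move=> [|k] kn; [exact: ideal_in_subalgebra AI|exact: sJ].
by move=> [|k] kn; [rewrite J0|exact: iJ].
Qed.

(** Surjectivity makes the image of the chain end at the whole of M. *)
Lemma image_subideal L M (f : L -> M) (I : set L) : lie_hom f ->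
  range f = setT -> lie_subideal I -> lie_subideal (f @` I).
Proof.
move=> hf rf [n [J [J0 Jn sJ iJ]]].
exists n, (fun k => f @` J k); split; rewrite ?J0 ?Jn //.
  by move=> k kn; apply: hom_image_subalgebra => //; exact: sJ.
by move=> k kn; apply: hom_image_ideal_in => //; exact: iJ.
Qed.

Lemma ideal_trivial L (A : set L) : lie_subspace A -> lie_ideal_in [set 0] A.
Proof.
move=> [A0 _]; split; [exact: subspace0|by move=> _ ->|].
by move=> x _ _ ->; rewrite lie0r.
Qed.

Lemma commutative_line_ideal L (A : set L) x : lie_subspace A ->
  lie_commutative A -> A x -> lie_ideal_in (line x) A.
Proof.
move=> sA cA Ax; split; first exact: line_subspace.
  by move=> _ [a _ <-]; exact: subspaceZ.
move=> y _ Ay [a _ <-]; rewrite lieZr cA // scaler0.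
by case: (line_subspace x).
Qed.

Lemma line_commutative L (x : L) : lie_commutative (line x).
Proof.
move=> _ _ [a _ <-] [b _ <-].
by rewrite lieZl lieZr lie_alternating !scaler0.
Qed.

Lemma finite_dim_line L (x : L) : finite_dim (line x).
Proof.
exists [:: x]; rewrite -lin_span1; congr lin_span; apply/seteqP.
by split=> y /=; rewrite inE => /eqP.
Qed.

Lemma finite_dim_closed L (A : set L) : finite_dim A -> closed A.
Proof. by move=> [s ->]; exact: closed_finite_span. Qed.

Lemma closed_line L (x : L) : closed (line x).
Proof. by apply: finite_dim_closed; exact: finite_dim_line. Qed.

Lemma derived_subspace L (A : set L) : lie_subspace (derived A).
Proof. exact: lin_span_subspace. Qed.

Lemma mem_derived L (A : set L) x y : A x -> A y -> derived A (lie x y).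
Proof. by move=> Ax Ay; apply: sub_lin_span; exists x => //; exists y. Qed.

Lemma derived_min L (A V : set L) : lie_subspace V ->
  (forall x y, A x -> A y -> V (lie x y)) -> derived A `<=` V.
Proof.
move=> sV AV; apply: lin_span_min => // _ [x Ax [y Ay <-]]; exact: AV.
Qed.

Lemma derivedS L (A B : set L) : A `<=` B -> derived A `<=` derived B.
Proof.
move=> AB; apply: derived_min; first exact: derived_subspace.
by move=> x y /AB Bx /AB By; exact: mem_derived.
Qed.

Lemma iter_derivedS L n (A B : set L) : A `<=` B ->
  iter n derived A `<=` iter n derived B.
Proof. by move=> AB; elim: n => //= n; exact: derivedS. Qed.

Lemma derived_ideal L (A : set L) : lie_subalgebra A ->
  lie_ideal_in (derived A) A.
Proof.
move=> [sA AA]; have dA : derived A `<=` A by exact: derived_min.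
split=> //; first exact: derived_subspace.
by move=> x y Ax /dA Ay; exact: mem_derived.
Qed.

Lemma derived0_commutative L (A : set L) :
  derived A = [set 0] -> lie_commutative A.
Proof. by move=> A0 x y Ax Ay; have := mem_derived Ax Ay; rewrite A0. Qed.

Lemma commutative_solvable L (A : set L) : lie_commutative A -> lie_solvable A.
Proof.
move=> cA; exists 1%N; apply/seteqP; split=> /=.
  by apply: derived_min => [|x y Ax Ay]; [exact: subspace0|exact: cA].
by move=> _ ->; case: (derived_subspace A).
Qed.

Lemma iter_derived0 L n (A : set L) : lie_subspace A ->
  iter n derived A 0.
Proof.
by case: n => [[]//|n _ /=]; case: (derived_subspace (iter n derived A)).
Qed.

Lemma solvableS L (A B : set L) : lie_subspace A -> A `<=` B ->
  lie_solvable B -> lie_solvable A.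
Proof.
move=> sA AB [n Bn]; exists n; apply/seteqP; split.
  by rewrite -Bn; exact: iter_derivedS.
by move=> _ ->; exact: iter_derived0.
Qed.

Definition line_subideal L (x : L) := lie_subideal (line x).

(** Lines are closed, commutative and finite-dimensional at once, so this condition is detected by
    all three preradicals and makes no reference to any of them. *)
Definition line_semisimple L := forall x : L, line_subideal x -> x = 0.

Lemma line_subidealP L : line_semisimple L <->
  (forall I : set L, lie_subideal I -> lie_commutative I -> finite_dim I ->
    I = [set 0]).
Proof.
split=> [ssL I sI cI _|h x sx]; last first.
  have lx := h _ sx (@line_commutative _ x) (finite_dim_line x).
  by have := mem_line x; rewrite lx.
have [s1 _] := subideal_subalgebra sI.
apply/seteqP; split=> [x Ix|_ ->]; last by case: s1.
by apply: ssL; apply: (ideal_in_subideal sI); exact: commutative_line_ideal.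
Qed.

Lemma semisimple_solvable L (I : set L) : line_semisimple L ->
  lie_subideal I -> lie_solvable I -> I = [set 0].
Proof.
move=> ssL sI [n]; elim: n I sI => //= n IH I sI; rewrite -iterS iterSr.
have [s1 _] := subideal_subalgebra sI.
move=> /IH h; have {}h : derived I = [set 0].
  apply: h; apply: (ideal_in_subideal sI); apply: derived_ideal.
  exact: subideal_subalgebra.
have cI := derived0_commutative h.
apply/seteqP; split=> [x Ix|_ ->]; last by case: s1.
by apply: ssL; apply: (ideal_in_subideal sI); exact: commutative_line_ideal.
Qed.

Definition solvable_ideal_span L : set L := closed_span
  (\bigcup_(I in [set I : set L | lie_ideal I /\ lie_solvable I]) I).

Definition solvable_subideal_span L : set L := closed_span
  (\bigcup_(I in [set I : set L | lie_subideal I /\ lie_solvable I]) I).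

Lemma sub_solvable_subideal_span L (I : set L) : lie_subideal I ->
  lie_solvable I -> I `<=` @solvable_subideal_span L.
Proof. by move=> sI sol x Ix; apply: sub_closed_span; exists I. Qed.

Lemma image_solvable_subideal_span L M (f : L -> M) : lie_hom f ->
  range f = setT ->
  f @` @solvable_subideal_span L `<=` @solvable_subideal_span M.
Proof.
move=> hf rf; apply: hom_closed_span => //.
- exact: closed_span_subspace.
- exact: closed_closed_span.
move=> _ [x [I [sI solI] Ix] <-].
apply: (@sub_solvable_subideal_span _ (f @` I)); last by exists x.
  exact: image_subideal.
exact: image_solvable.
Qed.

Lemma semisimple_solvable_span L : line_semisimple L ->
  @solvable_subideal_span L `<=` [set 0].
Proof.
move=> ssL; apply: closed_span_min; [exact: subspace0|exact: closed0|].
by move=> x [I [sI solI] Ix]; rewrite -(semisimple_solvable ssL sI solI).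
Qed.

End LieSubsetTheory.

Section AdmissibleMaps.
Context {R : realType}.
Implicit Types (L M N : banachLieType R) (P : ideal_map R).

(* The three properties of S_Isol, S_Abel and the centre that are used; they
   force superposition P to lie between the one-dimensional subideals and the
   closed span of the solvable subideals. *)
Definition admissible P :=
  [/\ forall L, P L `<=` @solvable_ideal_span R L,
      forall L, lie_commutative [set: L] -> P L = setT &
      forall L M (f : L -> M) (g : M -> L), lie_iso_pair f g ->
        f @` P L `<=` P M].

Lemma subalg_val_hom L (I : set L) (hI : closed_subalgebra I) :
  lie_hom (@subalg_val R L I hI).
Proof. by split=> //; exists 1 => x; rewrite mul1r. Qed.

Lemma subalg_val_range L (I : set L) (hI : closed_subalgebra I) :
  range (@subalg_val R L I hI) = I.
Proof.
apply/seteqP; split=> [_ [x _ <-]|x Ix].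
  exact/set_mem/(subalg_valP x).
by exists (Subalg (hI := hI) (mem_set Ix)).
Qed.

Lemma map_on_subalgebra_sub P L (I : set L) (hI : closed_subalgebra I) :
  map_on_subalgebra P hI `<=` I.
Proof. by move=> _ [x _ <-]; exact/set_mem/(subalg_valP x). Qed.

Variable P : ideal_map R.
Hypothesis hP : admissible P.

Lemma superposition_subspace L : lie_subspace (superposition P L).
Proof. exact: closed_span_subspace. Qed.

Lemma superposition_closed L : closed (superposition P L).
Proof. exact: closed_closed_span. Qed.

(** A solvable ideal of a subideal I is a solvable subideal of L, and the inclusion of I is bounded,
    so it carries closed spans computed in I into closed spans in L. *)
Lemma superposition_sub_span L :
  superposition P L `<=` @solvable_subideal_span R L.
Proof.
apply: closed_span_min; [exact: closed_span_subspace|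
  exact: closed_closed_span|].
move=> x [I [sI [hI PI]]]; rewrite -PI => PIx.
have [P1 _ _] := hP; have hv := subalg_val_hom hI.
suff sub : @subalg_val R L I hI @` @solvable_ideal_span R (subalg hI) `<=`
    @solvable_subideal_span R L.
  by apply: sub; case: PIx => y /P1; exists y.
apply: hom_closed_span => //; [exact: closed_span_subspace|
  exact: closed_closed_span|].
move=> _ [y [J [iJ solJ] Jy] <-].
apply: (@sub_solvable_subideal_span _ _ (@subalg_val R L I hI @` J)).
- apply: (ideal_in_subideal sI).
  by have := hom_image_ideal_in hv iJ; rewrite subalg_val_range.
- exact: image_solvable.
- by exists y.
Qed.

Lemma line_subideal_superposition L (x : L) : line_subideal x ->
  superposition P L x.
Proof.
move=> sx; apply: sub_closed_span; exists (line x); last exact: mem_line.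
split=> //; have hI : closed_subalgebra (line x).
  by split; [exact: closed_line|exact: subideal_subalgebra].
exists hI; have [_ P2 _] := hP; rewrite /map_on_subalgebra P2.
  exact: subalg_val_range.
move=> y z _ _; apply: val_inj => /=.
by apply: (@line_commutative _ _ x); apply/set_mem/subalg_valP.
Qed.

Lemma Sem_superposition L : Sem (superposition P) L <-> line_semisimple L.
Proof.
split=> [S0 x /line_subideal_superposition|ssL].
  by rewrite S0.
apply/seteqP; split=> [x /superposition_sub_span|_ ->].
  exact: semisimple_solvable_span.
by case: (superposition_subspace L).
Qed.

(** f restricts to an isomorphism from I onto f(I), and admissibility transports P(I) = I along this
    restriction. *)
Lemma iso_superposition L (f g : L -> L) (I : set L) : lie_iso_pair f g ->
  lie_subideal I ->
  (exists hI : closed_subalgebra I, map_on_subalgebra P hI = I) ->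
  f @` I `<=` superposition P L.
Proof.
move=> fg sI [hI PI]; have [hf hg fK gK] := fg.
have rf : range f = setT.
  by apply/seteqP; split=> // x _; exists (g x).
(* A bounded map need not send closed sets to closed sets; as a preimage under the bounded map g,
   the image is closed. *)
have fI : f @` I = g @^-1` I.
  apply/seteqP; split=> [_ [x Ix <-]|x Ix] /=; first by rewrite fK.
  by exists (g x).
have hJ : closed_subalgebra (f @` I).
  split; last by apply: hom_image_subalgebra => //; exact: subideal_subalgebra.
  by rewrite fI; apply: closed_preimage_hom => //; have [] := hI.
have fP (x : subalg hI) : f (subalg_val x) \in subalg_pred hJ.
  by apply/mem_set; exists (subalg_val x) => //; apply/set_mem/subalg_valP.
have gP (x : subalg hJ) : g (subalg_val x) \in subalg_pred hI.
  apply/mem_set; have /set_mem [y Iy yx] := subalg_valP x.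
  by rewrite -yx fK.
pose f' x : subalg hJ := Subalg (fP x).
pose g' x : subalg hI := Subalg (gP x).
have fg' : lie_iso_pair f' g'.
  split.
  - case: hf => lf bf [k kf]; split.
    + by move=> a x y; apply: val_inj; exact: lf.
    + by move=> x y; apply: val_inj; exact: bf.
    + by exists k => x; exact: kf.
  - case: hg => lf bf [k kf]; split.
    + by move=> a x y; apply: val_inj; exact: lf.
    + by move=> x y; apply: val_inj; exact: bf.
    + by exists k => x; exact: kf.
  - by move=> x; apply: val_inj; exact: fK.
  - by move=> x; apply: val_inj; exact: gK.
have [_ _ P3] := hP; have {}P3 := P3 _ _ _ _ fg'.
move=> x fIx; apply: sub_closed_span; exists (f @` I) => //.
split; first exact: image_subideal.
exists hJ; apply/seteqP; split; first exact: map_on_subalgebra_sub.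
move=> _ [y Iy <-]; have [z Pz <-] : map_on_subalgebra P hI y by rewrite PI.
by exists (f' z) => //; apply: P3; exists z.
Qed.

(* Invariance under exp(t ad a) gives invariance under its derivative ad a at
   t = 0. *)
Lemma superposition_ideal L : closed_ideal (superposition P L).
Proof.
split; first exact: superposition_closed.
split; [exact: superposition_subspace|by []|].
move=> a v _; set V := superposition P L.
have sV : lie_subspace V by exact: superposition_subspace.
have cV : closed V by exact: superposition_closed.
suff : V `<=` (lie a @^-1` V) by apply.
apply: closed_span_min.
- by apply: subspace_preimage => // b x y; exact: lie_linearr.
- move=> x /closure_decayP[y Vy xy]; apply: (closed_decay cV Vy).
  have [t t0 ht] := @lie_bounded R L.
  apply: (geom_decay_le (_ : 0 <= t * `|a|) xy); last first.
    by move=> n; rewrite -lieNr -lieDr; exact: ht.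
  by rewrite mulr_ge0 // ltW.
move=> {}v [I [sI PI] Iv] /=.
have [phi [psi [s [iso _ dec]]]] := exp_ad_exists a v.
apply: (@closed_decay _ _ V (fun n => s n *: (phi n v - v))) => //; last first.
  by apply: (eq_geom_decay _ (geom_decayN dec)) => n; rewrite opprB.
move=> n; apply: (@subspaceZ _ _ V) => //; apply: (@subspaceB _ _ V) => //.
  by apply: (iso_superposition (iso n) sI PI); exists v.
by apply: sub_closed_span; exists I.
Qed.

End AdmissibleMaps.

(** * The three admissible maps *)

Section AdmissibleExamples.
Context {R : realType}.
Implicit Types (L M : banachLieType R).

Lemma iso_range L M (f : L -> M) (g : M -> L) : lie_iso_pair f g ->
  range f = setT.
Proof. by case=> _ _ _ gK; apply/seteqP; split=> // x _; exists (g x). Qed.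

Lemma image_lie_ideal L M (f : L -> M) (I : set L) : lie_hom f ->
  range f = setT -> lie_ideal I -> lie_ideal (f @` I).
Proof. by move=> hf rf /(hom_image_ideal_in hf); rewrite rf. Qed.

Lemma image_finite_dim L M (f : L -> M) (I : set L) : lie_hom f ->
  finite_dim I -> finite_dim (f @` I).
Proof.
move=> hf [s ->]; exists (map f s); rewrite image_lin_span //; congr lin_span.
apply/seteqP; split=> [_ [x xs <-]|y /= /mapP[x xs ->]]; last by exists x.
exact: map_f.
Qed.

Lemma S_Isol_admissible : admissible (S_Isol R).
Proof.
split=> [L|L cL|L M f g fg].
- apply: closed_span_min; [exact: closed_span_subspace|
    exact: closed_closed_span|].
  by move=> x [I [iI _ sI] Ix]; apply: sub_closed_span; exists I.
- apply/seteqP; split=> // x _; apply: sub_closed_span.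
  exists (line x); last exact: mem_line; split.
  + exact: commutative_line_ideal.
  + exact: finite_dim_line.
  + by apply: commutative_solvable; exact: line_commutative.
- have [hf _ _ _] := fg; apply: hom_closed_span => //.
  + exact: closed_span_subspace.
  + exact: closed_closed_span.
  move=> _ [x [I [iI fI sI] Ix] <-]; apply: sub_closed_span.
  exists (f @` I); last by exists x.
  split; [|exact: image_finite_dim|exact: image_solvable].
  by apply: image_lie_ideal => //; exact: iso_range fg.
Qed.

Lemma S_Abel_admissible : admissible (S_Abel R).
Proof.
split=> [L|L cL|L M f g fg].
- apply: closed_span_min; [exact: closed_span_subspace|
    exact: closed_closed_span|].
  move=> x [I [[_ iI] sI] Ix]; apply: sub_closed_span; exists I => //.
  by split=> //; exact: commutative_solvable.
- apply/seteqP; split=> // x _; apply: sub_closed_span.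
  by exists setT => //; split=> //; split=> //; exact: closedT.
- have [hf hg fK gK] := fg; apply: hom_closed_span => //.
  + exact: closed_span_subspace.
  + exact: closed_closed_span.
  move=> _ [x [I [[cI iI] sI] Ix] <-]; apply: sub_closed_span.
  exists (f @` I); last by exists x.
  split; last first.
    move=> _ _ [u Iu <-] [v Iv <-]; have [_ <- _] := hf.
    by rewrite sI // (lie_hom0 hf).
  split; last by apply: image_lie_ideal => //; exact: iso_range fg.
  suff -> : f @` I = g @^-1` I by exact: closed_preimage_hom.
  apply/seteqP; split=> [_ [u Iu <-]|u Iu] /=; first by rewrite fK.
  by exists (g u).
Qed.

Lemma lie_decay0 L (u : nat -> L) z : geom_decay u ->
  geom_decay (fun n => lie (u n) z).
Proof.
move=> hu; have [t t0 ht] := @lie_bounded R L.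
apply: (geom_decay_le (_ : 0 <= t * `|z|) hu); last first.
  by move=> n; rewrite (le_trans (ht _ _)) // mulrAC.
by rewrite mulr_ge0 // ltW.
Qed.

Lemma center_subspace L : lie_subspace (@lie_center R L).
Proof.
split=> [y|a x y cx cy z]; first by rewrite lie0l.
by rewrite lie_linearl cx cy scaler0 addr0.
Qed.

Lemma center_ideal L : closed_ideal (@lie_center R L).
Proof.
split; last first.
  split; [exact: center_subspace|by []|].
  by move=> x y _ cy z; rewrite (lieC x) cy oppr0 lie0l.
move=> x /closure_decayP[y cy xy] z; apply: geom_decay_cst.
apply: (eq_geom_decay _ (lie_decay0 z xy)) => n.
by rewrite lieDl lieNl cy subr0.
Qed.

Lemma K_center_admissible : admissible (K_center R).
Proof.
split=> [L x cx|L cL|L M f g fg].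
- apply: sub_closed_span; exists (@lie_center R L) => //; split.
    by case: (center_ideal L).
  by apply: commutative_solvable => y z cy _; exact: cy.
- by apply/seteqP; split=> // x _ y; exact: cL.
- have [[_ hf _] _ _ gK] := fg.
  by move=> _ [x cx <-] y; rewrite -[y]gK -hf cx (lie_hom0 _) //; case: fg.
Qed.

Lemma K_center_preradical : is_preradical (K_center R).
Proof.
split=> [L|L M f [[k kf] lf df]]; first exact: center_ideal.
move=> _ [c cc <-] m; apply: contrapT => cm.
(* B is closed and contains the range of f; by density its complement, which is open, cannot contain
   m. *)
pose B : set M := [set m | lie (f c) m = 0].
have cB : closed B.
  move=> x /closure_decayP[y By xy]; apply: geom_decay_cst.
  apply: (eq_geom_decay _ (geom_decayN (lie_decay0 (f c) xy))) => n.
  by rewrite -lieC lieDr lieNr By subr0.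
have nB : (~` B) !=set0 by exists m.
have oB : open (~` B) by rewrite openC.
have [y [By [x _ xE]]] := df _ nB oB.
by apply: By; rewrite -xE /B /= -lf cc linear0.
Qed.

Lemma K_center_lower_stable : lower_stable (K_center R).
Proof.
move=> L; have [cZ [sZ _ iZ]] := center_ideal L.
have h : closed_subalgebra (K_center R L).
  (* Here [I] is the proof of [True], that is, of membership in [setT]. *)
  exact: (conj cZ (conj sZ (fun x y _ Zy => iZ x y I Zy))).
exists h; apply/seteqP; split; first exact: map_on_subalgebra_sub.
move=> x Zx; exists (Subalg (hI := h) (mem_set Zx)) => // y.
by apply: val_inj; exact: Zx.
Qed.

End AdmissibleExamples.

(** * The transfinite chain *)

Section GoodIdeals.
Context {R : realType}.
Implicit Types (L M : banachLieType R).

Lemma quotient_map_hom L (J : set L) (hJ : closed_ideal J) :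
  lie_hom (quotient_map hJ).
Proof.
split=> [a x y|x y|]; first by rewrite quotient_mapD quotient_mapZ.
  exact: quotient_map_lie.
by exists 1 => x; rewrite mul1r; exact: quotient_norm_le.
Qed.

Lemma quotient_map_range L (J : set L) (hJ : closed_ideal J) :
  range (quotient_map hJ) = setT.
Proof.
by apply/seteqP; split=> // q _; exists (quotient_repr q);
  rewrite ?quotient_reprK.
Qed.

Lemma quotient_map_eq0 L (J : set L) (hJ : closed_ideal J) x :
  quotient_map hJ x = 0 <-> J x.
Proof. by rewrite -(quotient_map0 hJ) quotient_mapP subr0. Qed.

Lemma preimage_ideal L M (f : L -> M) (I : set M) : lie_hom f ->
  lie_ideal I -> lie_ideal (f @^-1` I).
Proof.
move=> hf [sI _ iI]; split=> //.
  by apply: subspace_preimage => //; case: hf.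
by move=> x y _ Iy /=; have [_ -> _] := hf; exact: iI.
Qed.

Definition semisimple_quotient L (J : set L) :=
  exists hJ : closed_ideal J, line_semisimple (lie_quotient hJ).

(** The canonical map L/J -> L/J', computed on chosen representatives; it has this meaning only when
    J is contained in J'. *)
Definition quotient_factor L (J J' : set L) (hJ : closed_ideal J)
    (hJ' : closed_ideal J') (q : lie_quotient hJ) : lie_quotient hJ' :=
  quotient_map hJ' (quotient_repr q).

Lemma quotient_factorE L (J J' : set L) (hJ : closed_ideal J)
    (hJ' : closed_ideal J') x : J `<=` J' ->
  quotient_factor hJ' (quotient_map hJ x) = quotient_map hJ' x.
Proof.
move=> JJ'; apply/quotient_mapP/JJ'/(quotient_mapP hJ).
by rewrite quotient_reprK.
Qed.

Lemma quotient_factor_hom L (J J' : set L) (hJ : closed_ideal J)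
    (hJ' : closed_ideal J') : J `<=` J' ->
  lie_hom (@quotient_factor L J J' hJ hJ').
Proof.
move=> JJ'; split.
- move=> a; elim/quotient_ind => x; elim/quotient_ind => y.
  rewrite -quotient_mapZ -quotient_mapD !quotient_factorE //.
  by rewrite quotient_mapD quotient_mapZ.
- elim/quotient_ind => x; elim/quotient_ind => y.
  have [_ hq _] := quotient_map_hom hJ; rewrite -hq !quotient_factorE //.
  exact: quotient_map_lie.
- exists 1 => q; rewrite mul1r; apply: quotient_norm_lb => x <-.
  by rewrite quotient_factorE //; exact: quotient_norm_le.
Qed.

Lemma quotient_factor_range L (J J' : set L) (hJ : closed_ideal J)
    (hJ' : closed_ideal J') : J `<=` J' ->
  range (@quotient_factor L J J' hJ hJ') = setT.
Proof.
move=> JJ'; apply/seteqP; split=> //; elim/quotient_ind => x _.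
by exists (quotient_map hJ x) => //; rewrite quotient_factorE.
Qed.

Variable P : ideal_map R.
Hypothesis hP : admissible P.
Local Notation Q := (superposition P).

Lemma next_iterateE L (J : set L) (hJ : closed_ideal J) :
  next_iterate Q J = quotient_map hJ @^-1` Q (lie_quotient hJ).
Proof.
apply/seteqP; split=> x; last by exists hJ.
(* The quotient type depends on the proof that J is a closed ideal; proof irrelevance identifies the
   two quotients. *)
by move=> [hJ']; rewrite (Prop_irrelevance hJ' hJ).
Qed.

Lemma sub_next_iterate L (J : set L) : closed_ideal J ->
  J `<=` next_iterate Q J.
Proof.
move=> hJ x Jx; rewrite (next_iterateE hJ) /=.
have -> : quotient_map hJ x = 0 by exact/quotient_map_eq0.
by case: (superposition_subspace P (lie_quotient hJ)).
Qed.

Lemma next_iterate_ideal L (J : set L) : closed_ideal J ->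
  closed_ideal (next_iterate Q J).
Proof.
move=> hJ; rewrite (next_iterateE hJ); have hq := quotient_map_hom hJ.
have [cQ iQ] := superposition_ideal hP (lie_quotient hJ).
by split; [exact: closed_preimage_hom|exact: preimage_ideal].
Qed.

Lemma next_iterate_fixed L (J : set L) : closed_ideal J ->
  next_iterate Q J = J -> semisimple_quotient J.
Proof.
move=> hJ NJ; exists hJ => q sq; rewrite -[q]quotient_reprK.
apply/quotient_map_eq0; have {}NJ : next_iterate Q J `<=` J by rewrite NJ.
apply: NJ.
rewrite (next_iterateE hJ) /= quotient_reprK.
exact: line_subideal_superposition.
Qed.

(** The map L/J -> L/J' sends the span of the solvable subideals of L/J, hence also P^s(L/J), into
    the corresponding span of L/J', which is zero. *)
Lemma next_iterate_sub L (J J' : set L) : closed_ideal J -> J `<=` J' ->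
  semisimple_quotient J' -> next_iterate Q J `<=` J'.
Proof.
move=> hJ JJ' [hJ' ss] x; rewrite (next_iterateE hJ) /=.
move=> /(superposition_sub_span hP) Tx; apply/(quotient_map_eq0 hJ').
apply: (semisimple_solvable_span ss); rewrite -(quotient_factorE hJ hJ' _ JJ').
apply: (image_solvable_subideal_span (quotient_factor_hom hJ hJ' JJ')
  (quotient_factor_range hJ hJ' JJ')).
by exists (quotient_map hJ x).
Qed.

End GoodIdeals.

(** * Well-orders and transfinite recursion *)

Section WellOrder.
Variables (W : eqType) (le : rel W).
Hypothesis wo : wochoice.well_order le.

Lemma wo_min (A : set W) : A !=set0 ->
  exists2 z, A z & forall x, A x -> le z x.
Proof.
move=> [x Ax]; have [|z [[zA lbz] _]] := wo (A := fun u => `[< A u >]).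
  by exists x; apply/asboolP.
exists z; first exact/asboolP.
by move=> y Ay; apply: lbz; apply/asboolP.
Qed.

Lemma wo_total x y : le x y \/ le y x.
Proof.
have [|z [->|->] h] := @wo_min [set u | u = x \/ u = y].
- by exists x; left.
- by left; apply: h; right.
- by right; apply: h; left.
Qed.

Lemma wo_refl x : le x x.
Proof. by case: (wo_total x x). Qed.

(** A well-order is one in which nonempty subsets have a unique minimum; antisymmetry is this
    uniqueness for {x, y}. *)
Lemma wo_anti x y : le x y -> le y x -> x = y.
Proof.
move=> xy yx; have [|z [_ u]] := wo (A := fun u => (u == x) || (u == y)).
  by exists x; rewrite unfold_in eqxx.
have hx : z = x.
  apply: u; split; first by rewrite unfold_in eqxx.
  by move=> v; rewrite unfold_in => /orP[/eqP->|/eqP->] //; exact: wo_refl.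
have hy : z = y.
  apply: u; split; first by rewrite unfold_in eqxx orbT.
  by move=> v; rewrite unfold_in => /orP[/eqP->|/eqP->] //; exact: wo_refl.
by rewrite -hx.
Qed.

Local Notation lt := (wo_lt le).

Lemma wo_ltP x y : lt x y <-> ~ le y x.
Proof.
split=> [/andP[/eqP xy lxy] lyx|nyx]; first exact/xy/wo_anti.
apply/andP; split; last by case: (wo_total x y).
by apply: contra_notN nyx => /eqP->; exact: wo_refl.
Qed.

Lemma wo_ind (X : W -> Prop) :
  (forall w, (forall v, lt v w -> X v) -> X w) -> forall w, X w.
Proof.
move=> h w; apply: contrapT => nXw.
have [|z nXz hz] := @wo_min [set u | ~ X u]; first by exists w.
apply: nXz; apply: h => v /wo_ltP vz; apply: contrapT => nXv.
by apply: vz; exact: hz.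
Qed.

Lemma wo_lt_wf : well_founded lt.
Proof. by apply: wo_ind => w h; constructor. Qed.

Lemma wo_successor_uniq v v' w :
  is_successor le v w -> is_successor le v' w -> v = v'.
Proof. by move=> [vw h] [vw' h']; apply: wo_anti; [exact: h'|exact: h]. Qed.

Lemma wo_successor_exists v w : lt v w ->
  exists2 s, is_successor le v s & le s w.
Proof.
move=> vw; have [|s vs hs] := @wo_min [set u | lt v u]; first by exists w.
exists s; last exact: hs.
split=> // u /wo_ltP us; apply: contrapT => uv; apply: us; apply: hs.
exact/wo_ltP.
Qed.

(** Extending the earlier values by the empty set lets F take a plain function on W, free of proofs
    that a position is earlier. *)
Lemma transfinite_rec (T : Type) (F : W -> (W -> set T) -> set T) :
  exists c : W -> set T,
    forall w, c w = F w (fun v => if lt v w then c v else set0).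
Proof.
pose G w (rec : forall v, lt v w -> set T) := F w (fun v =>
  if pselect (lt v w) is left h then rec v h else set0).
exists (Fix wo_lt_wf (fun=> set T) G) => w.
rewrite Fix_eq; last first.
  move=> u f g fg; rewrite /G; congr F; apply/funext => v.
  by case: pselect.
rewrite /G; congr F; apply/funext => v.
by case: pselect => [->|/negP/negbTE->].
Qed.

Lemma transfinite_iterates_exist (R : realType) (P : ideal_map R)
    (L : banachLieType R) : exists c : W -> set L, transfinite_iterates le P c.
Proof.
(* The three clauses exclude one another and a successor has a single predecessor, so their union
   acts as a case distinction. *)
have [c hc] := transfinite_rec (fun w (g : W -> set L) =>
  [set x | [\/ is_zero le w /\ x = 0,
               exists2 v, is_successor le v w & next_iterate P (g v) x |
               is_limit le w /\ closure (\bigcup_(v in lt^~ w) g v) x]]).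
exists c; split=> [w w0|v w vw|w lw]; rewrite hc.
- apply/seteqP; split=> [x|_ ->]; last exact: Or31.
  case=> [[]//|[v [vw _] _]|[[]//]].
  by have := w0 v; rewrite vw.
- have [ltvw _] := vw; apply/seteqP; split=> [x|x Nx]; last first.
    by apply: Or32; exists v => //; rewrite ltvw.
  case=> [[w0 _]|[v' vw' +]|[[_ nw] _]].
  + by have := w0 v; rewrite ltvw.
  + by rewrite (wo_successor_uniq vw' vw) ltvw.
  + by case: nw; exists v.
- have -> : \bigcup_(v in lt^~ w) (if lt v w then c v else set0) =
      \bigcup_(v in lt^~ w) c v by apply: eq_bigcupr => v /= ->.
  apply/seteqP; split=> [x|x cx]; last exact: Or33.
  by case: lw => nz ns [[]//|[v vw _]|[]//]; case: ns; exists v.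
Qed.

End WellOrder.

(** Diagonal argument: D collects the values f A lying outside A, and for injective f the point f D
    is in D exactly when it is not. *)
Lemma cantor_set (T : Type) (f : set T -> T) : ~ injective f.
Proof.
move=> fI; pose D := [set x | exists2 A, x = f A & ~ A x].
have [D1|nD] := pselect (D (f D)); last by apply: (nD); exists D.
by case: (D1) => A /fI <-.
Qed.

(** * Stabilization and minimality *)

Section Star.
Context {R : realType}.
Implicit Types L : banachLieType R.
Variable P : ideal_map R.
Hypothesis hP : admissible P.
Local Notation Q := (superposition P).

Lemma closed_ideal0 L : closed_ideal [set 0 : L].
Proof. by split; [exact: closed0|exact: ideal_trivial]. Qed.

Lemma closure_ideal L (J : set L) : lie_ideal J -> closed_ideal (closure J).
Proof.
move=> [sJ _ iJ]; split; first exact: closed_closure.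
split; [exact: closure_subspace|by []|].
move=> x y _ /closure_decayP[z Jz yz]; apply/closure_decayP.
exists (fun n => lie x (z n)); first by move=> n; exact: iJ.
apply: (eq_geom_decay _ (geom_decayN (lie_decay0 x yz))) => n.
by rewrite lieDl lieNl opprB addrC -lieC (lieC x y).
Qed.

Section Chain.
Variables (L : banachLieType R) (W : eqType) (le : rel W) (c : W -> set L).
Hypotheses (wo : wochoice.well_order le) (hc : transfinite_iterates le Q c).
Local Notation lt := (wo_lt le).

(** The two properties need a joint induction: growth at a successor uses that the previous value is
    a closed ideal, and at a limit the union is a subspace because the earlier values are nested. *)
Lemma chain_ideal w : closed_ideal (c w) /\ forall v, lt v w -> c v `<=` c w.
Proof.
have [c0 cS cl] := hc; elim/(wo_ind wo): w => w IH.
have [w0|nw0] := pselect (is_zero le w).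
  rewrite c0 //; split; first exact: closed_ideal0.
  by move=> v vw; have := w0 v; rewrite vw.
have [[u uw]|nu] := pselect (exists u, is_successor le u w).
  have [luw hu] := uw; have [iu mu] := IH u luw.
  rewrite (cS _ _ uw); split; first exact: next_iterate_ideal.
  move=> v vw; have uN := sub_next_iterate P iu.
  have [->//|vu] := eqVneq v u.
  apply: subset_trans uN; apply: mu; rewrite /wo_lt vu /=; exact: hu.
rewrite cl //; split; last first.
  by move=> v vw x cx; apply: subset_closure; exists v.
apply: closure_ideal; split=> //; last first.
  move=> x y _ [v vw cy]; exists v => //.
  by have [[_ [_ _ iv]] _] := IH v vw; exact: iv.
split.
  have [v vw] : exists v, lt v w.
    by apply: contra_notP nw0 => h v; apply/negP => vw; apply: h; exists v.
  by exists v => //; have [[_ [[]]]] := IH v vw.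
have le_mono v v' : lt v' w -> le v v' -> c v `<=` c v'.
  move=> vw vv'; have [->//|nvv'] := eqVneq v v'.
  by have [_] := IH v' vw; apply; rewrite /wo_lt nvv'.
have sub v : lt v w -> lie_subspace (c v).
  by move=> vw; have [[_ []]] := IH v vw.
move=> a x y [v vw cx] [v' vw' cy].
have [vv'|vv'] := wo_total wo v v'.
  exists v' => //; have [_] := sub _ vw'; apply=> //; exact: (le_mono v).
exists v => //; have [_] := sub _ vw; apply=> //; exact: (le_mono v').
Qed.

Lemma chain_sub w J : semisimple_quotient J -> c w `<=` J.
Proof.
move=> ssJ; have [hJ _] := ssJ; have [c0 cS cl] := hc.
elim/(wo_ind wo): w => w IH.
have [w0|nw0] := pselect (is_zero le w).
  by rewrite c0 // => _ ->; case: hJ => _ [[]].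
have [[u uw]|nu] := pselect (exists u, is_successor le u w).
  rewrite (cS _ _ uw); apply: (next_iterate_sub hP _ _ ssJ).
    by case: (chain_ideal u).
  by apply: IH; case: uw.
have [cJ _] := hJ.
rewrite cl // ((closure_id J).1 cJ); apply: closureS.
by move=> x [v vw]; exact: IH.
Qed.

Lemma chain_stabilizes : ~ injective c ->
  exists w, next_iterate Q (c w) = c w.
Proof.
have [_ cS _] := hc; apply: contra_notP => ns v w vw.
(* If c a = c b with a < b, the value at the successor of a is squeezed between them, so the chain
   already stabilizes at a. *)
have key a b : lt a b -> c a <> c b.
  move=> ab cab; apply: ns; exists a; apply/seteqP; split; last first.
    by apply: sub_next_iterate; case: (chain_ideal a).
  have [s as_ sb] := wo_successor_exists wo ab.
  rewrite -(cS _ _ as_) cab; have [->//|nsb] := eqVneq s b.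
  by have [_] := chain_ideal b; apply; rewrite /wo_lt nsb.
apply: (wo_anti wo); apply: contrapT => /(wo_ltP wo) h.
  exact: (key _ _ h).
exact: (key _ _ h).
Qed.

End Chain.

(* The recursion runs over a well-ordering of set (set L), which by Cantor is
   too long for the chain to be injective. *)
Lemma star_superposition L : semisimple_quotient (star Q L) /\
  forall J, semisimple_quotient J -> star Q L `<=` J.
Proof.
have [le wo] := wochoice.well_ordering_principle {classic (set (set L))}.
have [c hc] := transfinite_iterates_exist wo Q L.
have [w cw] := chain_stabilizes wo hc (@cantor_set (set L) c).
have gw : semisimple_quotient (c w).
  by apply: (next_iterate_fixed hP) cw; case: (chain_ideal wo hc w).
(* Any chain, over any well-order, stays inside c w because L / c w is semisimple. *)
have -> : star Q L = c w.
  apply/seteqP; split=> [x|x cx]; last by exists _, le, c, w.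
  move=> [W' [le' [c' [w' [wo' hc' _]]]]]; exact: (chain_sub wo' hc').
by split=> // J; exact: (chain_sub wo hc).
Qed.

End Star.

(** * The finite-dimensional case *)

Section FiniteDimension.
Context {R : realType} {L : banachLieType R}.
Implicit Types (A B V : set L).

(** Induction on the spanning list replaces a dimension count. If no member of F contains some x + y
    with y in the span of s, all members lie in that span. Otherwise consider the members that do,
    intersected with the span of s: a larger member contains the same x + y, so the inclusion can be
    tested on the intersections. *)
Lemma noetherian (s : seq L) (F : set (set L)) : F !=set0 ->
  (forall A, F A -> lie_subspace A /\ A `<=` lin_span [set` s]) ->
  exists2 A, F A & forall B, F B -> A `<=` B -> B `<=` A.
Proof.
elim: s F => [|x s IH] F [A0 FA0] hF.
  exists A0 => // B FB _; have [_] := hF B FB; rewrite lin_span_nil => B0.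
  by move=> y /B0 ->; have [[]] := hF A0 FA0.
have sS := lin_span_subspace [set` s].
have [[A1 FA1 [y [Sy A1y]]]|nF] := pselect (exists2 A, F A &
    exists y, lin_span [set` s] y /\ A (x + y)); last first.
  apply: IH; first by exists A0.
  move=> A FA; have [sA AS] := hF A FA; split=> // z Az.
  have := AS z Az; rewrite lin_span_cons => -[u Su [_ [a _ <-] uaz]].
  have [a0|a0] := eqVneq a 0; first by rewrite -uaz a0 scale0r addr0.
  case: nF; exists A => //; exists (a^-1 *: u).
  split; first exact: (subspaceZ _ sS).
  rewrite addrC -[x](scalerK a0) -scalerDr uaz; exact: subspaceZ.
pose F1 A := F A /\ exists y, lin_span [set` s] y /\ A (x + y).
have [| |_ [A [FA [z [Sz Az]]] <-] hA] :=
    IH [set A `&` lin_span [set` s] | A in F1].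
- by exists (A1 `&` lin_span [set` s]); exists A1 => //; split=> //; exists y.
- move=> _ [A [FA _] <-]; have [sA _] := hF A FA.
  by split; [exact: subspaceI|move=> u []].
exists A => // B FB AB b Bb.
have [sB BS] := hF B FB; have [sA _] := hF A FA.
have Bz := AB _ Az.
have := BS b Bb; rewrite lin_span_cons => -[u Su [_ [a _ <-] ub]].
have [|||Abz _] := hA (B `&` lin_span [set` s]) _ _ (b - a *: (x + z)).
- by exists B => //; split=> //; exists z.
- by move=> v [/AB Bv Sv].
- split; first by apply: subspaceB => //; exact: subspaceZ.
  have -> : b - a *: (x + z) = u - a *: z.
    by rewrite -ub scalerDr opprD addrA addrK.
  by apply: (subspaceB sS) => //; exact: (subspaceZ _ sS).
by rewrite -[b](subrK (a *: (x + z))); apply: subspaceD => //; exact: subspaceZ.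
Qed.

(** A maximal span of finitely many vectors of A is all of A, since adjoining any further vector of
    A does not enlarge it; finite spans are closed. *)
Lemma subspace_closed A : finite_dim [set: L] -> lie_subspace A -> closed A.
Proof.
move=> [s sT] sA.
have [| |_ [t tA <-] ht] := @noetherian s
    [set lin_span [set` t] | t in [set t : seq L | [set` t] `<=` A]].
- by exists (lin_span [set` [::]]), [::].
- move=> _ [t _ <-]; split; first exact: lin_span_subspace.
  by rewrite -sT.
suff -> : A = lin_span [set` t] by exact: closed_finite_span.
apply/seteqP; split; last exact: lin_span_min.
move=> x Ax; apply: (ht (lin_span [set` x :: t])).
- exists (x :: t) => // y /=; rewrite inE => /predU1P[->//|]; exact: tA.
- rewrite lin_span_cons; apply: sub_suml; exact: line_subspace.
- by apply: sub_lin_span; rewrite /= mem_head.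
Qed.

End FiniteDimension.

(** * Solvability of sums and extensions *)

Section SolvableExtensions.
Context {R : realType}.
Implicit Types (L M : banachLieType R).

Lemma iter_derived_sub L n (A : set L) : lie_subalgebra A ->
  iter n derived A `<=` A.
Proof.
move=> [sA AA]; elim: n => //= n IH; apply: derived_min => // x y /IH Ax /IH Ay.
exact: AA.
Qed.

Lemma sum_ideal_in L (B I J : set L) : lie_subspace J ->
  lie_ideal_in B J -> lie_ideal_in I J -> lie_ideal_in (sum_set B I) J.
Proof.
move=> sJ [sB BJ iB] [sI IJ iI]; split; [exact: sum_subspace|exact: sum_min|].
move=> x _ Jx [b Bb [i Ii <-]]; rewrite lieDr.
by exists (lie x b); [exact: iB|exists (lie x i) => //; exact: iI].
Qed.

Lemma sum_solvable L (B I J : set L) : lie_ideal_in B J -> lie_ideal_in I J ->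
  lie_solvable B -> lie_solvable I -> lie_solvable (sum_set B I).
Proof.
move=> iB iI [n Bn] [m Im].
have [sB BJ _] := iB; have [sI IJ JI] := iI.
have aB := ideal_in_subalgebra iB.
(* Modulo I, the derived series of B + I is that of B; after n steps it lies in I, and m further
   steps kill it. *)
have sub k : iter k derived (sum_set B I) `<=` sum_set (iter k derived B) I.
  elim: k => //= k IH; have XJ : iter k derived B `<=` J.
    by apply: subset_trans BJ; exact: iter_derived_sub.
  apply: (subset_trans (derivedS IH)); apply: derived_min.
    by apply: sum_subspace => //; exact: derived_subspace.
  move=> _ _ [x Xx [i Ii <-]] [x' Xx' [i' Ii' <-]].
  exists (lie x x'); first exact: mem_derived.
  exists (lie x i' + lie i (x' + i')); last by rewrite addrA -lieDr -lieDl.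
  apply: subspaceD => //; first by apply: JI => //; exact: XJ.
  rewrite lieDr; apply: subspaceD => //; last by apply: JI => //; exact: IJ.
  by rewrite lieC; apply: subspaceN => //; apply: JI => //; exact: XJ.
exists (m + n)%N; rewrite iterD; apply/seteqP; split; last first.
  by move=> _ ->; rewrite -iterD; apply: iter_derived0; exact: sum_subspace.
rewrite -Im; apply: iter_derivedS; apply: (subset_trans (sub n)).
by rewrite Bn; apply: sum_min => // _ ->; case: sI.
Qed.

(** After n steps the derived series of A lies in the kernel of f, hence in B. *)
Lemma solvable_extension L M (f : L -> M) (A B : set L) : lie_hom f ->
  lie_subalgebra A -> (forall x, A x -> f x = 0 -> B x) ->
  lie_solvable (f @` A) -> lie_solvable B -> lie_solvable A.
Proof.
move=> hf aA AB [n fAn] [m Bm]; exists (m + n)%N; rewrite iterD.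
apply/seteqP; split; last first.
  by move=> _ ->; rewrite -iterD; apply: iter_derived0; case: aA.
rewrite -Bm; apply: iter_derivedS => x Ax; apply: AB.
  exact: (iter_derived_sub aA Ax).
have : iter n derived (f @` A) (f x).
  elim: n x Ax {fAn} => [|n IH] x /=; first by exists x.
  move: x; apply: derived_min.
    apply: subspace_preimage; [by case: hf|exact: derived_subspace].
  move=> x y /IH fx /IH fy /=; have [_ -> _] := hf; exact: mem_derived.
by rewrite fAn.
Qed.

End SolvableExtensions.

(** * Radicals and subideals *)

Section Radical.
Context {R : realType}.
Implicit Types (L : banachLieType R).

Definition is_radical_in L (B J : set L) :=
  [/\ lie_ideal_in B J, lie_solvable B &
      forall I, lie_ideal_in I J -> lie_solvable I -> I `<=` B].

(** A maximal solvable ideal B is the greatest one, because B + I is again a solvable ideal for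
    every solvable ideal I. *)
Lemma radical_exists L (J : set L) : finite_dim [set: L] -> lie_subspace J ->
  exists B, is_radical_in B J.
Proof.
move=> [s sT] sJ.
have [| |B [iB solB] hB] := @noetherian R L s
    [set I | lie_ideal_in I J /\ lie_solvable I].
- exists [set 0]; split; first exact: ideal_trivial.
  by apply: commutative_solvable => x y -> ->; rewrite lie0r.
- by move=> A [[sA _ _] _]; split=> //; rewrite -sT.
exists B; split=> // I iI solI; have [sB _ _] := iB.
apply: (@subset_trans _ (sum_set B I)); first exact: sub_sumr.
apply: hB; last by apply: sub_suml; case: iI.
by split; [exact: sum_ideal_in|exact: (sum_solvable iB iI)].
Qed.

(* The radical of an ideal J of J' is invariant under exp(t ad a) for a in J',
   hence under ad a. *)
Lemma radical_ideal_in L (B J J' : set L) : finite_dim [set: L] ->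
  is_radical_in B J -> lie_ideal_in J J' -> lie_ideal_in B J'.
Proof.
move=> fL [[sB BJ iB] solB maxB] [sJ JJ' iJ].
split=> //; first exact: subset_trans JJ'.
move=> a v J'a Bv; have [phi [psi [s [iso stable dec]]]] := exp_ad_exists a v.
apply: (@closed_decay _ _ B (fun n => s n *: (phi n v - v))); last first.
- by apply: (eq_geom_decay _ (geom_decayN dec)) => n; rewrite opprB.
- move=> n; apply: subspaceZ => //; apply: subspaceB => //.
  have [hf hg fK gK] := iso n.
  have [phiJ psiJ] := stable n J sJ (subspace_closed fL sJ)
    (fun x => iJ a x J'a).
  suff : phi n @` B `<=` B by apply; exists v.
  apply: maxB; last exact: image_solvable.
  split; first exact: hom_image_subspace.
    by move=> _ [x Bx <-]; apply: phiJ; exact: BJ.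
  move=> y _ Jy [b Bb <-]; exists (lie (psi n y) b).
    by apply: iB => //; exact: psiJ.
  by have [_ -> _] := hf; rewrite gK.
exact: subspace_closed.
Qed.

Lemma solvable_subideal_radical L (B I : set L) : finite_dim [set: L] ->
  is_radical_in B setT -> lie_subideal I -> lie_solvable I -> I `<=` B.
Proof.
move=> fL [_ _ maxB] [n [J [J0 Jn sJ iJ]]] solI.
suff /(_ n (leqnn n)) [C [iC solC _] IC] : forall k, (k <= n)%N ->
    exists2 C, is_radical_in C (J k) & I `<=` C.
  by rewrite Jn in iC; exact: subset_trans (maxB _ iC solC).
elim=> [_|k IH kn].
  have [C radC] := radical_exists fL (sJ 0 isT).1.
  exists C => //; have [_ _] := radC; apply=> //; rewrite J0.
  by have [sI II] := sJ 0 isT; rewrite J0 in sI II; split.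
have [C radC IC] := IH (ltnW kn); have [_ solC _] := radC.
have [D radD] := radical_exists fL (sJ _ kn).1.
exists D => //; apply: (subset_trans IC); have [_ _] := radD; apply=> //.
exact: (radical_ideal_in fL radC (iJ k kn)).
Qed.

(** The preimage of the radical C of L/B is an extension of a solvable algebra by B, so it is a
    solvable ideal and lies in B. Every line that is a subideal of L/B lies in C and therefore
    vanishes. *)
Lemma radical_semisimple_quotient L (B : set L) : finite_dim [set: L] ->
  is_radical_in B setT -> semisimple_quotient B.
Proof.
move=> fL [iB solB maxB]; have sB : lie_subspace B by case: iB.
have hB : closed_ideal B by split=> //; exact: subspace_closed.
exists hB; have hq := quotient_map_hom hB; have rq := quotient_map_range hB.
have fQ : finite_dim [set: lie_quotient hB].
  by rewrite -rq; exact: image_finite_dim.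
have [C radC] := radical_exists fQ (subspaceT (L := lie_quotient hB)).
have [iC solC _] := radC.
have iqC := preimage_ideal hq iC.
have CB : quotient_map hB @^-1` C `<=` B.
  have aC := ideal_in_subalgebra iqC.
  apply: (maxB _ iqC); apply: (solvable_extension hq aC _ _ solB).
    by move=> x _ /quotient_map_eq0.
  apply: solvableS solC; last by move=> _ [x ? <-].
  by apply: hom_image_subspace => //; case: aC.
elim/quotient_ind => x sx; apply/quotient_map_eq0/CB => /=.
apply: (solvable_subideal_radical fQ radC sx); last exact: mem_line.
by apply: commutative_solvable; exact: line_commutative.
Qed.

Lemma star_superposition_radical (P : ideal_map R) L : admissible P ->
  finite_dim [set: L] -> is_solvable_radical (star (superposition P) L).
Proof.
move=> hP fL; have [[hG ssG] minG] := star_superposition hP L.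
have [cG iG] := hG.
have sG : lie_subspace (star (superposition P) L) by case: iG.
have [B radB] := radical_exists fL (subspaceT (L := L)).
have [_ solB _] := radB.
split=> //.
  apply: (solvableS sG _ solB); apply: minG.
  exact: radical_semisimple_quotient.
move=> I iI solI x Ix; apply/(quotient_map_eq0 hG).
have hq := quotient_map_hom hG.
have iq : lie_ideal (quotient_map hG @` I).
  by apply: image_lie_ideal => //; exact: quotient_map_range.
have sq := image_solvable hq solI.
have : (quotient_map hG @` I) (quotient_map hG x) by exists x.
by rewrite (semisimple_solvable ssG (ideal_in_subideal (@subidealT _ _) iq) sq).
Qed.

Lemma star_superposition_eq (P P' : ideal_map R) L : admissible P ->
  admissible P' -> star (superposition P) L = star (superposition P') L.
Proof.
move=> hP hP'; have [gS minS] := star_superposition hP L.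
have [gS' minS'] := star_superposition hP' L.
by apply/seteqP; split; [exact: minS|exact: minS'].
Qed.

End Radical.

Theorem theorem6p20 (R : realType) :
  [/\ (forall L : banachLieType R,
         Sem (superposition (S_Isol R)) L <->
         Sem (superposition (S_Abel R)) L) /\
      (forall L : banachLieType R,
         Sem (superposition (S_Abel R)) L <->
         (forall I : set L, lie_subideal I -> lie_commutative I ->
            finite_dim I -> I = [set 0])),
      [/\ is_preradical (K_center R),
          lower_stable (K_center R) &
          forall L : banachLieType R,
            star (superposition (S_Isol R)) L =
              star (superposition (S_Abel R)) L /\
            star (superposition (S_Abel R)) L =
              star (superposition (K_center R)) L] &
      forall L : banachLieType R, finite_dim [set: L] ->
        is_solvable_radical (star (superposition (S_Abel R)) L)].
Proof.
have hI := @S_Isol_admissible R; have hA := @S_Abel_admissible R.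
have hK := @K_center_admissible R.
split.
- split=> L; first by rewrite !Sem_superposition.
  by rewrite Sem_superposition // line_subidealP.
- split; [exact: K_center_preradical|exact: K_center_lower_stable|].
  by move=> L; split; exact: star_superposition_eq.
- by move=> L; exact: star_superposition_radical.
Qed.
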